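(* Every right-angled Artin group is in the class $\mathcal{A}_n$ for all $n\geq 0$.
   Context: A right-angled Artin group is any group with a finite generating set $X$ and a presentation of the form $\langle X\mid [x,y]=1\ \text{for all } (x,y)\in\Sigma\rangle$ for some subset $\Sigma$ of $X\times X$. For a group $G$, let $\hat{G}$ be its profinite completion and $c_G:G\to\hat{G}$ the completion map. For a nonnegative integer $n$, $\mathcal{A}_n$ is the class of all groups $G$ such that, for every finite discrete $\hat{G}$-module $A$, the map $H^i_c(\hat{G},A)\to H^i(G,A)$ induced by $c_G$, from continuous to ordinary (discrete) group cohomology, is bijective for $0\leq i\leq n$ and injective for $i=n+1$ (equivalently, surjective for $0\le i\le n$). *)

(* Defs.v *)
From HB Require Import structures.
From mathcomp Require Import all_boot all_order all_algebra.
From mathcomp Require Import mathcomp_extra boolp classical_sets functions.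
From mathcomp Require Import cardinality filter topology function_spaces.
Set Implicit Arguments.
Unset Strict Implicit.
Unset Printing Implicit Defensive.

Import GRing.Theory.
Local Open Scope classical_set_scope.
Local Open Scope quotient_scope.
Local Open Scope group_scope.

(* The letter [(x, true)] stands for the generator x, [(x, false)] for its
   inverse. *)
Definition word (X : Type) := seq (X * bool).

Definition eval_word (X : Type) (G : groupType) (gen : X -> G) (w : word X) : G :=
  \prod_(p <- w) (if p.2 then gen p.1 else (gen p.1)^-1).

(* Equality of words in the group < X | r = 1, r in R >. *)
Inductive pres_eq (X : Type) (R : set (word X)) : word X -> word X -> Prop :=
| pres_eq_refl w : pres_eq R w w
| pres_eq_sym v w : pres_eq R v w -> pres_eq R w v
| pres_eq_trans u v w : pres_eq R u v -> pres_eq R v w -> pres_eq R u w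
| pres_eq_cancel u v x b :
    pres_eq R (u ++ [:: (x, b); (x, ~~ b)] ++ v) (u ++ v)
| pres_eq_relator u v r : R r -> pres_eq R (u ++ r ++ v) (u ++ v).

Definition has_presentation (X : Type) (G : groupType) (gen : X -> G)
    (R : set (word X)) : Prop :=
  (forall g, exists w, eval_word gen w = g) /\
  (forall v w, eval_word gen v = eval_word gen w <-> pres_eq R v w).

Definition commutator_word (X : Type) (x y : X) : word X :=
  [:: (x, false); (y, false); (x, true); (y, true)].

Definition right_angled_Artin (G : groupType) : Prop :=
  exists (X : finType) (gen : X -> G) (Sigma : {set X * X}),
    has_presentation gen
      [set commutator_word s.1 s.2 | s in [set` Sigma]].

HB.mixin Record isTopologicalGroup G of Group G & Topological G := {
  mulg_continuous : continuous (fun p : G * G => (p.1 * p.2 : G));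
  invg_continuous : continuous (fun x : G => x^-1)
}.

#[short(type="topologicalGroupType")]
HB.structure Definition TopologicalGroup :=
  {G of isTopologicalGroup G & Group G & Topological G}.

Lemma prod_continuous (T : topologicalType) (I : Type) (K : I -> topologicalType)
    (f : T -> prod_topology K) :
  (forall i, continuous (fun t => f t i)) -> continuous f.
Proof.
move=> cf t; apply/cvg_sup => i.
by apply: continuous_comp_initial => {}t; exact: cf.
Qed.

Definition left_coset (G : groupType) (N : set G) (g : G) : set G :=
  [set g * h | h in N].

Record normal_fin_index (G : groupType) := NormalFinIndex {
  nfi_set :> set G;
  nfi1 : nfi_set 1;
  nfiM : forall x y, nfi_set x -> nfi_set y -> nfi_set (x * y);
  nfiV : forall x, nfi_set x -> nfi_set x^-1;
  nfiJ : forall x g, nfi_set x -> nfi_set (x ^ g);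
  nfi_finite : finite_set (range (left_coset nfi_set))
}.

Section FiniteQuotient.
Variables (G : groupType) (N : normal_fin_index G).

Definition same_coset (x y : G) : bool := `[< nfi_set N (x^-1 * y) >].

Lemma same_coset_equiv : equiv_class_of same_coset.
Proof.
split=> [x|x y|y x z].
- by apply/asboolP; rewrite mulVg; exact: nfi1.
- by apply/asboolP/asboolP => /nfiV; rewrite invgM invgK.
- move=> /asboolP xy /asboolP yz; apply/asboolP.
  by have := nfiM xy yz; rewrite mulgA mulgK.
Qed.

Canonical same_coset_rel := EquivRelPack same_coset_equiv.
Canonical same_coset_encModRel := defaultEncModRel same_coset.

Definition fin_quot := {eq_quot same_coset}.

HB.instance Definition _ : EqQuotient G same_coset fin_quot :=
  EqQuotient.on fin_quot.
HB.instance Definition _ := Choice.on fin_quot.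

Definition fin_quot_one : fin_quot := lift_cst fin_quot 1.
Definition fin_quot_mul := lift_op2 fin_quot *%g.
Definition fin_quot_inv := lift_op1 fin_quot (fun x => x^-1).

Lemma same_cosetP x y : reflect (nfi_set N (x^-1 * y)) (x == y %[mod fin_quot]).
Proof. by rewrite eqmodE; exact: asboolP. Qed.

Fact fin_quot_pi1_subproof : \pi_fin_quot 1 = fin_quot_one.
Proof. by rewrite /fin_quot_one; unlock. Qed.

Fact fin_quot_piM_subproof : {morph \pi_fin_quot : x y / x * y >-> fin_quot_mul x y}.
Proof.
move=> x y; unlock fin_quot_mul; apply/eqP/same_cosetP.
set x' := repr _; set y' := repr _.
have xx' : nfi_set N (x^-1 * x') by apply/same_cosetP; rewrite reprK.
have yy' : nfi_set N (y^-1 * y') by apply/same_cosetP; rewrite reprK.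
suff -> : (x * y)^-1 * (x' * y') = (x^-1 * x') ^ y * (y^-1 * y').
  by apply: nfiM => //; exact: nfiJ.
by rewrite /conjg invgM -!mulgA mulVKg.
Qed.

Fact fin_quot_piV_subproof : {morph \pi_fin_quot : x / x^-1 >-> fin_quot_inv x}.
Proof.
move=> x; unlock fin_quot_inv; apply/eqP/same_cosetP.
set x' := repr _.
have xx' : nfi_set N (x^-1 * x') by apply/same_cosetP; rewrite reprK.
suff -> : x^-1^-1 * x'^-1 = ((x^-1 * x')^-1) ^ x^-1.
  exact/nfiJ/nfiV.
by rewrite /conjg invgM !invgK -!mulgA mulgV mulg1.
Qed.

Fact fin_quot_mulA : associative fin_quot_mul.
Proof.
by move=> x y z; rewrite -[x]reprK -[y]reprK -[z]reprK -!fin_quot_piM_subproof mulgA.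
Qed.

Fact fin_quot_mul1 : left_id fin_quot_one fin_quot_mul.
Proof. by move=> x; rewrite -[x]reprK -fin_quot_pi1_subproof -fin_quot_piM_subproof mul1g. Qed.

Fact fin_quot_1mul : right_id fin_quot_one fin_quot_mul.
Proof. by move=> x; rewrite -[x]reprK -fin_quot_pi1_subproof -fin_quot_piM_subproof mulg1. Qed.

Fact fin_quot_mulV : left_inverse fin_quot_one fin_quot_inv fin_quot_mul.
Proof.
move=> x; rewrite -[x]reprK -fin_quot_piV_subproof -fin_quot_piM_subproof mulVg.
exact: fin_quot_pi1_subproof.
Qed.

Fact fin_quot_Vmul : right_inverse fin_quot_one fin_quot_inv fin_quot_mul.
Proof.
move=> x; rewrite -[x]reprK -fin_quot_piV_subproof -fin_quot_piM_subproof mulgV.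
exact: fin_quot_pi1_subproof.
Qed.

HB.instance Definition _ := isGroup.Build fin_quot fin_quot_mulA fin_quot_mul1
  fin_quot_1mul fin_quot_mulV fin_quot_Vmul.

Lemma fin_quot_pi1 : \pi_fin_quot 1 = 1 :> fin_quot.
Proof. exact: fin_quot_pi1_subproof. Qed.

Lemma fin_quot_piM (x y : G) :
  \pi_fin_quot (x * y) = \pi_fin_quot x * \pi_fin_quot y :> fin_quot.
Proof. exact: fin_quot_piM_subproof. Qed.

Lemma fin_quot_piV (x : G) : \pi_fin_quot x^-1 = (\pi_fin_quot x)^-1 :> fin_quot.
Proof. exact: fin_quot_piV_subproof. Qed.

End FiniteQuotient.

(* The transition map G/N -> G/M, which is only used for N `<=` M. *)
Definition fin_quot_map (G : groupType) (N M : normal_fin_index G)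
  (q : fin_quot N) : fin_quot M := \pi_(fin_quot M) (repr q).

Lemma fin_quot_map_pi (G : groupType) (N M : normal_fin_index G) (g : G) :
  N `<=` M -> fin_quot_map M (\pi_(fin_quot N) g) = \pi_(fin_quot M) g.
Proof.
move=> NM; apply/eqP/same_cosetP/NM/same_cosetP.
by rewrite reprK.
Qed.

Lemma fin_quot_mapM (G : groupType) (N M : normal_fin_index G) :
  N `<=` M -> {morph @fin_quot_map G N M : x y / x * y}.
Proof.
move=> NM x y; rewrite -[x]reprK -[y]reprK -[LHS]/(fin_quot_map M _).
by rewrite -fin_quot_piM !fin_quot_map_pi// fin_quot_piM.
Qed.

Lemma fin_quot_mapV (G : groupType) (N M : normal_fin_index G) :
  N `<=` M -> {morph @fin_quot_map G N M : x / x^-1}.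
Proof.
move=> NM x; rewrite -[x]reprK.
by rewrite -fin_quot_piV !fin_quot_map_pi// fin_quot_piV.
Qed.

Definition compatible_family (G : groupType) :
    set (prod_topology (fun N : normal_fin_index G => discrete_topology (fin_quot N))) :=
  [set x | forall N M : normal_fin_index G,
             N `<=` M -> fin_quot_map M (x N) = x M].

(* The inverse limit of the G/N, as a subspace of the product of the discrete
   spaces G/N. *)
Definition profinite_completion (G : groupType) : Type :=
  set_type (@compatible_family G).

Section ProfiniteCompletion.
Variable G : groupType.
Local Notation Ghat := (profinite_completion G).

HB.instance Definition _ := Topological.on Ghat.

Definition pc_coord (x : Ghat) (N : normal_fin_index G) : fin_quot N := \val x N.

Lemma pc_coordP (x : Ghat) (N M : normal_fin_index G) :
  N `<=` M -> fin_quot_map M (pc_coord x N) = pc_coord x M.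
Proof. by move=> NM; have /set_mem := valP x; exact. Qed.

Definition pc_mk (x : forall N : normal_fin_index G, fin_quot N)
    (xP : forall N M : normal_fin_index G, N `<=` M -> fin_quot_map M (x N) = x M) :
  Ghat := SigSub (mem_set xP : x \in @compatible_family G).

Lemma pc_ext (x y : Ghat) : (forall N, pc_coord x N = pc_coord y N) -> x = y.
Proof. by move=> xy; apply: val_inj; apply: functional_extensionality_dep. Qed.

Fact pc_one_subproof (N M : normal_fin_index G) :
  N `<=` M -> fin_quot_map M (1 : fin_quot N) = 1.
Proof. by move=> NM; rewrite -!fin_quot_pi1 fin_quot_map_pi. Qed.

Fact pc_mul_subproof (x y : Ghat) (N M : normal_fin_index G) : N `<=` M ->
  fin_quot_map M (pc_coord x N * pc_coord y N) = pc_coord x M * pc_coord y M.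
Proof. by move=> NM; rewrite fin_quot_mapM// !pc_coordP. Qed.

Fact pc_inv_subproof (x : Ghat) (N M : normal_fin_index G) : N `<=` M ->
  fin_quot_map M (pc_coord x N)^-1 = (pc_coord x M)^-1.
Proof. by move=> NM; rewrite fin_quot_mapV// !pc_coordP. Qed.

Definition pc_one : Ghat := pc_mk pc_one_subproof.
Definition pc_mul (x y : Ghat) : Ghat := pc_mk (pc_mul_subproof x y).
Definition pc_inv (x : Ghat) : Ghat := pc_mk (pc_inv_subproof x).

Fact pc_mulA : associative pc_mul.
Proof. by move=> x y z; apply: pc_ext => N; exact: mulgA. Qed.
Fact pc_mul1 : left_id pc_one pc_mul.
Proof. by move=> x; apply: pc_ext => N; exact: mul1g. Qed.
Fact pc_1mul : right_id pc_one pc_mul.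
Proof. by move=> x; apply: pc_ext => N; exact: mulg1. Qed.
Fact pc_mulV : left_inverse pc_one pc_inv pc_mul.
Proof. by move=> x; apply: pc_ext => N; exact: mulVg. Qed.
Fact pc_Vmul : right_inverse pc_one pc_inv pc_mul.
Proof. by move=> x; apply: pc_ext => N; exact: mulgV. Qed.

HB.instance Definition _ :=
  isGroup.Build Ghat pc_mulA pc_mul1 pc_1mul pc_mulV pc_Vmul.

Lemma pc_coord_continuous N :
  continuous (fun x : Ghat => pc_coord x N : discrete_topology _).
Proof.
move=> x; apply: (@cvg_comp _ _ _ (\val : Ghat -> prod_topology _)
    (fun z : prod_topology _ => z N)).
  exact: initial_continuous.
have /cvg_sup/(_ N) h : (\val x : prod_topology _) --> (\val x : prod_topology _).
  exact: cvg_id.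
by move=> A /initial_continuous /h.
Qed.

Lemma pc_continuousP (T : topologicalType) (f : T -> Ghat) :
  (forall N, continuous (fun t => pc_coord (f t) N : discrete_topology _)) ->
  continuous f.
Proof.
by move=> cf; apply: continuous_comp_initial; exact: prod_continuous.
Qed.

Lemma discrete_continuousP (T : topologicalType) (D : choiceType)
    (f : T -> discrete_topology D) :
  continuous f <-> forall t, \forall s \near t, f s = f t.
Proof.
have cvgP t : f @ t --> f t <-> \forall s \near t, f s = f t.
  exact: (@discrete_cvg (discrete_topology D)).
by split=> cf t; [exact: (cvgP t).1 (cf t) | exact: (cvgP t).2 (cf t)].
Qed.

Fact pc_mulg_continuous : continuous (fun p : Ghat * Ghat => p.1 * p.2 : Ghat).
Proof.
apply: pc_continuousP => N; apply/discrete_continuousP => -[x y] /=.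
have near_coord z := (discrete_continuousP _).1 (@pc_coord_continuous N) z.
exists ([set x' | pc_coord x' N = pc_coord x N],
        [set y' | pc_coord y' N = pc_coord y N]); first by split; exact: near_coord.
by move=> [x' y'] [/= xx' yy']; rewrite -[LHS]/(pc_coord x' N * pc_coord y' N) xx' yy'.
Qed.

Fact pc_invg_continuous : continuous (fun x : Ghat => x^-1 : Ghat).
Proof.
apply: pc_continuousP => N; apply/discrete_continuousP => x /=.
have := (discrete_continuousP _).1 (@pc_coord_continuous N) x.
by apply: filterS => x' xx'; rewrite -[LHS]/((pc_coord x' N)^-1) xx'.
Qed.

HB.instance Definition _ :=
  isTopologicalGroup.Build Ghat pc_mulg_continuous pc_invg_continuous.

Definition completion (g : G) : Ghat :=
  pc_mk (fun N M NM => @fin_quot_map_pi G N M g NM).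

Fact completion_morphism : monoid.monoid_morphism completion.
Proof.
split=> [|x y]; apply: pc_ext => N; first exact: fin_quot_pi1.
exact: fin_quot_piM.
Qed.

HB.instance Definition _ :=
  isUMagmaMorphism.Build G Ghat completion completion_morphism.

End ProfiniteCompletion.

Local Open Scope ring_scope.

Record cochain_complex := CochainComplex {
  cochain :> nat -> zmodType;
  diff : forall n, {additive cochain n -> cochain n.+1};
  diff_diff : forall n (x : cochain n), diff n.+1 (diff n x) = 0
}.

Section Cohomology.
Variables (K : cochain_complex) (n : nat).

Definition is_cocycle : {pred K n} := fun x => diff K n x == 0.

(* The complexes vanish in negative degrees. *)
Definition is_coboundary_of (m : nat) : K m -> Prop :=
  match m with
  | 0 => fun x => x = 0
  | m'.+1 => fun x => exists y : K m', x = diff K m' y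
  end.

Definition is_coboundary : {pred K n} := fun x => `[< is_coboundary_of x >].

Fact cocycle_zmod_closed : zmod_closed is_cocycle.
Proof.
split=> [|x y /eqP dx /eqP dy]; first by rewrite unfold_in raddf0.
by rewrite unfold_in raddfB dx dy subr0.
Qed.

HB.instance Definition _ :=
  GRing.isZmodClosed.Build (K n) is_cocycle cocycle_zmod_closed.

Record cocycle := Cocycle { cocycle_val :> K n; _ : cocycle_val \in is_cocycle }.
HB.instance Definition _ := [isSub for cocycle_val].
HB.instance Definition _ := [Choice of cocycle by <:].
HB.instance Definition _ := [SubChoice_isSubZmodule of cocycle by <:].

Definition coboundary : {pred cocycle} := fun z => cocycle_val z \in is_coboundary.

Fact coboundary_zmod_closed : zmod_closed coboundary.
Proof.
rewrite /coboundary /is_coboundary; split=> [|x y]; rewrite !unfold_in.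
  rewrite [cocycle_val 0](raddf0 (\val : cocycle -> K n)); apply/asboolP.
  by case: n => //= m; exists 0; rewrite raddf0.
rewrite [cocycle_val (x - y)](raddfB (\val : cocycle -> K n)) /=.
case: n (cocycle_val x) (cocycle_val y) => [|m] /= u v /asboolP uP /asboolP vP.
  by apply/asboolP; rewrite uP vP subr0.
have [[a ->] [b ->]] := (uP, vP).
by apply/asboolP; exists (a - b); rewrite raddfB.
Qed.

HB.instance Definition _ :=
  GRing.isZmodClosed.Build cocycle coboundary coboundary_zmod_closed.

Definition cohomology : zmodType := Quotient.quot coboundary.

End Cohomology.

Record cochain_map (K L : cochain_complex) := CochainMap {
  cmap :> forall n, {additive K n -> L n};
  cmap_diff : forall n (x : K n), cmap n.+1 (diff K n x) = diff L n (cmap n x)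
}.

Section CohomologyMap.
Variables (K L : cochain_complex) (f : cochain_map K L) (n : nat).

Fact cocycle_map_subproof (z : cocycle K n) : f n (cocycle_val z) \in @is_cocycle L n.
Proof.
case: z => x /= /eqP dx.
by rewrite unfold_in -cmap_diff dx raddf0.
Qed.

Definition cocycle_map (z : cocycle K n) : cocycle L n :=
  Cocycle (cocycle_map_subproof z).

(* Independent of the chosen representative: see cohomology_map_pi. *)
Definition cohomology_map (c : cohomology K n) : cohomology L n :=
  \pi_(cohomology L n) (cocycle_map (repr c)).

Lemma cohomology_map_pi (z : cocycle K n) :
  cohomology_map (\pi_(cohomology K n) z) = \pi_(cohomology L n) (cocycle_map z).
Proof.
rewrite /cohomology_map; set y := repr _.
have : y - z \in @coboundary K n by rewrite Quotient.idealrBE reprK.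
move=> yz; apply/eqP; rewrite -Quotient.idealrBE; move: yz.
rewrite !unfold_in => /asboolP yz; apply/asboolP.
rewrite [cocycle_val _](raddfB (\val : cocycle L n -> L n)) /=.
move: yz; rewrite [cocycle_val _](raddfB (\val : cocycle K n -> K n)) /=.
rewrite -raddfB; case: n (cocycle_val y - cocycle_val z) => [|m] /= x.
  by move->; rewrite raddf0.
by move=> [w ->]; exists (f m w); rewrite cmap_diff.
Qed.

End CohomologyMap.

Local Open Scope group_scope.

Record gmodule (G : groupType) := GModule {
  gmod :> zmodType;
  gact : G -> gmod -> gmod;
  gact1 : forall a, gact 1 a = a;
  gactM : forall g h a, gact (g * h) a = gact g (gact h a);
  gactD : forall g a b, gact g (a + b)%R = (gact g a + gact g b)%R
}.

Section Restriction.
Variables (G H : groupType) (phi : UMagmaMorphism.type G H) (M : gmodule H).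

Fact restr_gact1 (a : M) : gact (phi 1) a = a.
Proof. by rewrite gmulf1 gact1. Qed.

Fact restr_gactM (g h : G) (a : M) :
  gact (phi (g * h)) a = gact (phi g) (gact (phi h) a).
Proof. by rewrite gmulfM gactM. Qed.

Definition restr_gmodule : gmodule G :=
  GModule restr_gact1 restr_gactM (fun g => gactD (phi g)).

End Restriction.

Local Open Scope ring_scope.

Section Homogeneous.
Variables (G : groupType) (M : gmodule G).
Local Notation fn n := (('I_n.+1 -> G) -> M).

Lemma gactB (g : G) (a b : M) : gact g (a - b) = gact g a - gact g b.
Proof. by apply: (addIr (gact g b)); rewrite -gactD !subrK. Qed.

HB.instance Definition _ (g : G) :=
  GRing.isZmodMorphism.Build M M (gact g) (gactB g).

Definition equivariant n (f : fn n) : Prop :=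
  forall (g : G) (x : 'I_n.+1 -> G),
    f (fun i => (g * x i)%g) = gact g (f x).

(* (d f)(x_0, .., x_(n+1)) = \sum_i (-1)^i f(x_0, .., omit x_i, .., x_(n+1)) *)
Definition homog_diff n (f : fn n) : fn n.+1 :=
  fun x => \sum_(i < n.+2) f (x \o lift i) *~ (-1) ^+ i.

Fact homog_diff_equivariant n (f : fn n) :
  equivariant f -> equivariant (homog_diff f).
Proof.
move=> fP g x; rewrite /homog_diff raddf_sum; apply: eq_bigr => i _.
rewrite -[X in f X]/(fun j => (g * (x \o lift i) j)%g) fP.
by rewrite raddfMz.
Qed.

Fact homog_diffB n (f g : fn n) : homog_diff (f - g) = homog_diff f - homog_diff g.
Proof.
apply/funext => x; rewrite /homog_diff !fctE -sumrB; apply: eq_bigr => i _.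
by rewrite mulrzBl.
Qed.

Fact homog_diff_diff n (f : fn n) : homog_diff (homog_diff f) = 0.
Proof.
apply/funext => x; rewrite /homog_diff.
pose F (p : 'I_n.+3 * 'I_n.+2) : M :=
  f ((x \o lift p.1) \o lift p.2) *~ ((-1) ^+ p.2 * (-1) ^+ p.1).
pose h (p : 'I_n.+3 * 'I_n.+2) : 'I_n.+3 * 'I_n.+2 :=
  if (p.1 <= p.2)%N then (lift ord0 p.2, inord p.1) else (inord p.2, inord p.1.-1).
have hK : involutive h.
  move=> [i j]; rewrite /h /=; case: (leqP i j) => ij /=.
    have iE : (inord i : 'I_n.+2) = i :> nat.
      by rewrite inordK// (leq_ltn_trans ij).
    by rewrite iE /bump /= add1n ltnNge ij /= !inord_val.
  have i0 : (0 < i)%N by apply: leq_ltn_trans ij.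
  have jE : (inord j : 'I_n.+3) = j :> nat.
    by rewrite inordK// ltnW// ltnS.
  have iE : (inord i.-1 : 'I_n.+2) = i.-1 :> nat.
    by rewrite inordK// prednK// -ltnS.
  rewrite jE iE -ltnS prednK// ij inord_val.
  by congr pair; apply: val_inj; rewrite /= iE /bump add1n prednK.
transitivity (\sum_p F p).
  rewrite -(pair_bigA _ (fun i j => F (i, j))) /=; apply: eq_bigr => i _.
  by rewrite mulrz_suml; apply: eq_bigr => j _; rewrite /F mulrzA.
rewrite (bigID (fun p : 'I_n.+3 * 'I_n.+2 => (p.1 <= p.2)%N)) /=.
rewrite [X in _ + X](reindex_inj (inv_inj hK)) /=.
rewrite [X in _ + X](eq_bigl (fun p : 'I_n.+3 * 'I_n.+2 => (p.1 <= p.2)%N)); last first.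
  move=> [i j]; rewrite /h /=; case: (leqP i j) => ij /=.
    rewrite inordK ?(leq_ltn_trans ij)// /bump /= add1n ltnNge.
    by rewrite ij.
  have i0 : (0 < i)%N by apply: leq_ltn_trans ij.
  have ji : (j <= i.-1)%N by rewrite -ltnS prednK.
  have jE : (inord j : 'I_n.+3) = j :> nat by rewrite inordK// ltnW// ltnS.
  by rewrite jE inordK ?ji// prednK// -ltnS.
rewrite -big_split big1//= => -[i j] /= ij.
rewrite /F /h /= ij /= inordK ?(leq_ltn_trans ij)//.
have -> : (x \o lift (lift ord0 j)) \o lift (inord i) = (x \o lift i) \o lift j.
  apply/funext => k /=; congr x; apply: val_inj => /=.
  rewrite inordK ?(leq_ltn_trans ij)// [RHS]bumpC.
  by rewrite /unbump [(j < i)%N]ltnNge ij /= subn0 [bump i j]/bump ij.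
by rewrite /bump /= add1n exprS mulN1r mulrN mulrNz [(-1) ^+ i * _]mulrC subrr.
Qed.

Definition is_homog n : {pred fn n} := fun f => `[< equivariant f >].

Fact homog_zmod_closed n : zmod_closed (@is_homog n).
Proof.
split=> [|f h]; rewrite !unfold_in.
  by apply/asboolP => g x; rewrite [RHS](raddf0 (gact g)).
by move=> /asboolP fP /asboolP hP; apply/asboolP => g x; rewrite !fctE fP hP raddfB.
Qed.

HB.instance Definition _ n :=
  GRing.isZmodClosed.Build (fn n) (@is_homog n) (homog_zmod_closed n).

Record homog_cochain n :=
  HomogCochain { homog_val :> fn n; _ : homog_val \in @is_homog n }.
HB.instance Definition _ n := [isSub for @homog_val n].
HB.instance Definition _ n := [Choice of homog_cochain n by <:].
HB.instance Definition _ n := [SubChoice_isSubZmodule of homog_cochain n by <:].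

End Homogeneous.

Section HomogeneousComplex.
Variables (G : groupType) (M : gmodule G).

Fact homog_cochain_diff_subproof n (f : homog_cochain M n) :
  homog_diff f \in @is_homog G M n.+1.
Proof.
by case: f => f /[dup] /asboolP fP ?; apply/asboolP/homog_diff_equivariant.
Qed.

Definition homog_cochain_diff n (f : homog_cochain M n) : homog_cochain M n.+1 :=
  HomogCochain (homog_cochain_diff_subproof f).

Fact homog_cochain_diffB n : zmod_morphism (@homog_cochain_diff n).
Proof. by move=> f g; apply: val_inj; exact: homog_diffB. Qed.

HB.instance Definition _ n := GRing.isZmodMorphism.Build _ _
  (@homog_cochain_diff n) (@homog_cochain_diffB n).

Fact homog_cochain_diff_diff n (f : homog_cochain M n) :
  homog_cochain_diff (homog_cochain_diff f) = 0.
Proof. by apply: val_inj; exact: homog_diff_diff. Qed.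

Definition group_complex : cochain_complex :=
  @CochainComplex (fun n => homog_cochain M n) (fun n => @homog_cochain_diff n)
    homog_cochain_diff_diff.

End HomogeneousComplex.

Definition group_cohomology (G : groupType) (M : gmodule G) (n : nat) : zmodType :=
  cohomology (group_complex M) n.

Section ContinuousComplex.
Variables (G : topologicalGroupType) (M : gmodule G).
Local Notation fn n := (('I_n.+1 -> G) -> M).

Definition continuous_cochain n (f : fn n) : Prop :=
  continuous (f : prod_topology (fun _ : 'I_n.+1 => G) -> discrete_topology M).

Definition is_cont_homog n : {pred fn n} :=
  fun f => `[< equivariant f /\ continuous_cochain f >].

Fact cont_homog_zmod_closed n : zmod_closed (@is_cont_homog n).
Proof.
split=> [|f h]; rewrite !unfold_in.
  apply/asboolP; split; first by move=> g x; rewrite [RHS](raddf0 (gact g)).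
  by apply/discrete_continuousP => x; near=> y.
move=> /asboolP[fP fc] /asboolP[hP hc]; apply/asboolP; split.
  by move=> g x; rewrite !fctE fP hP raddfB.
apply/discrete_continuousP => x.
have := (discrete_continuousP _).1 fc x; have := (discrete_continuousP _).1 hc x.
by apply: filterS2 => y /= hy fy; rewrite !fctE hy fy.
Unshelve. all: by end_near. Qed.

HB.instance Definition _ n := GRing.isZmodClosed.Build (fn n) (@is_cont_homog n)
  (cont_homog_zmod_closed n).

Record cont_homog_cochain n := ContHomogCochain {
  cont_homog_val :> fn n;
  _ : cont_homog_val \in @is_cont_homog n
}.
HB.instance Definition _ n := [isSub for @cont_homog_val n].
HB.instance Definition _ n := [Choice of cont_homog_cochain n by <:].
HB.instance Definition _ n := [SubChoice_isSubZmodule of cont_homog_cochain n by <:].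

Fact homog_diff_continuous n (f : fn n) :
  continuous_cochain f -> continuous_cochain (homog_diff f).
Proof.
move=> /discrete_continuousP fc; apply/discrete_continuousP => x.
pose face (i : 'I_n.+2) (y : prod_topology (fun _ : 'I_n.+2 => G)) :
  prod_topology (fun _ : 'I_n.+1 => G) := y \o lift i.
have face_cont i : continuous (face i).
  by apply: prod_continuous => j; exact: proj_continuous.
have : \forall y \near (x : prod_topology (fun _ : 'I_n.+2 => G)),
    forall i : 'I_n.+2, f (face i y) = f (face i x).
  apply: (@filter_forall _ _ (fun i y => f (face i y) = f (face i x)) _
    (nbhs_filter x)) => i.
  exact: face_cont (fc (face i x)).
by apply: filterS => y fy; apply: eq_bigr => i _; rewrite [f _]fy.
Qed.

Fact cont_homog_diff_subproof n (f : cont_homog_cochain n) :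
  homog_diff f \in @is_cont_homog n.+1.
Proof.
case: f => f /[dup] /asboolP[fP fc] ?; apply/asboolP; split.
  exact: homog_diff_equivariant.
exact: homog_diff_continuous.
Qed.

Definition cont_homog_diff n (f : cont_homog_cochain n) : cont_homog_cochain n.+1 :=
  ContHomogCochain (cont_homog_diff_subproof f).

Fact cont_homog_diffB n : zmod_morphism (@cont_homog_diff n).
Proof. by move=> f g; apply: val_inj; exact: homog_diffB. Qed.

HB.instance Definition _ n := GRing.isZmodMorphism.Build _ _
  (@cont_homog_diff n) (@cont_homog_diffB n).

Fact cont_homog_diff_diff n (f : cont_homog_cochain n) :
  cont_homog_diff (cont_homog_diff f) = 0.
Proof. by apply: val_inj; exact: homog_diff_diff. Qed.

Definition continuous_complex : cochain_complex :=
  @CochainComplex (fun n => cont_homog_cochain n) (fun n => @cont_homog_diff n)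
    cont_homog_diff_diff.

End ContinuousComplex.

Definition continuous_cohomology (G : topologicalGroupType) (M : gmodule G)
  (n : nat) : zmodType := cohomology (continuous_complex M) n.

Definition finite_discrete_module (G : topologicalGroupType) (M : gmodule G) : Prop :=
  finite_set [set: M] /\
  continuous (fun p : G * discrete_topology M => gact p.1 p.2 : discrete_topology M).

Section Pullback.
Variables (G : groupType) (H : topologicalGroupType).
Variables (phi : UMagmaMorphism.type G H) (M : gmodule H).

Definition pullback n (f : ('I_n.+1 -> H) -> M) (x : 'I_n.+1 -> G) : M :=
  f (phi \o x).

Fact pullback_subproof n (f : cont_homog_cochain M n) :
  (pullback f : _ -> restr_gmodule phi M) \in @is_homog G (restr_gmodule phi M) n.
Proof.
case: f => f /[dup] /asboolP[fP _] ?; apply/asboolP => g x.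
rewrite /= /pullback -[RHS]fP; congr f; apply/funext => i /=.
by rewrite gmulfM.
Qed.

Definition pullback_cochain n (f : cont_homog_cochain M n) :
  homog_cochain (restr_gmodule phi M) n := HomogCochain (pullback_subproof f).

Fact pullback_cochainB n : zmod_morphism (@pullback_cochain n).
Proof. by move=> f g; apply: val_inj. Qed.

HB.instance Definition _ n := GRing.isZmodMorphism.Build _ _
  (@pullback_cochain n) (@pullback_cochainB n).

Fact pullback_cochain_diff n (f : cont_homog_cochain M n) :
  pullback_cochain (cont_homog_diff f) = homog_cochain_diff (pullback_cochain f).
Proof. by apply: val_inj. Qed.

Definition pullback_map :
    cochain_map (continuous_complex M) (group_complex (restr_gmodule phi M)) :=
  @CochainMap (continuous_complex M) (group_complex (restr_gmodule phi M))
    (fun n => @pullback_cochain n) pullback_cochain_diff.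

Definition pullback_cohomology (n : nat) :
    continuous_cohomology M n -> group_cohomology (restr_gmodule phi M) n :=
  @cohomology_map _ _ pullback_map n.

End Pullback.

Definition in_class_A (n : nat) (G : groupType) : Prop :=
  forall M : gmodule (profinite_completion G), finite_discrete_module M ->
    (forall i, (i <= n)%N ->
       bijective (@pullback_cohomology G _ (@completion G) M i)) /\
    injective (@pullback_cohomology G _ (@completion G) M n.+1).

(* Main.v *)
(* Let r_S : G -> G be the retraction killing the generators outside S, with
   fixed group G_S.  By induction on #|S| and the degree, every class of positive
   degree of G_S with coefficients in a finite module Map(G/N, M) dies after
   enlarging G/N.  For x in S, the group G_S acts on the tree with vertices
   G_S/G_(S \ x) and edges G_S/G_L, L the link of x: a class that dies on the
   vertex groups comes from a class of one degree less of the edge groups, which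
   dies by induction; only degree 1, where a class is a crossed homomorphism to a
   finite module, is treated directly.  Surjectivity of the coboundary from
   functions on vertices to functions on edges is deduced from the presentation,
   so that no normal form is needed.
   Continuous cochains on the profinite completion are the cochains on G that are
   right invariant under some normal subgroup of finite index, and dimension
   shifting along M -> Map(G/N, M) shows that the complex of all cochains modulo
   these is acyclic. *)
From HB Require Import structures.
Require Import Defs.
From mathcomp Require Import all_boot all_order all_algebra.
From mathcomp Require Import mathcomp_extra boolp classical_sets functions.
From mathcomp Require Import cardinality filter topology function_spaces.

Set Implicit Arguments.
Unset Strict Implicit.
Unset Printing Implicit Defensive.

Import GRing.Theory.
Local Open Scope classical_set_scope.
Local Open Scope group_scope.
Local Open Scope ring_scope.

(** * Normal subgroups of finite index *)

Lemma finite_ord_injection (T : Type) :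
  finite_set [set: T] -> exists n (e : T -> 'I_n.+1), injective e.
Proof.
move=> /(@finite_seqP {classic T})[s sE].
have sP (t : {classic T}) : (index t s < size s)%N.
  by rewrite index_mem; have := I : [set: {classic T}] t; rewrite sE.
exists (size s), (fun t => inord (index (t : {classic T}) s)) => t u.
move=> /(congr1 val) /=; rewrite !inordK; try by rewrite ltnW// ltnS.
move=> tu; rewrite -[t](nth_index (t : {classic T}) (s := s)) -?index_mem//.
by rewrite tu nth_index// -index_mem.
Qed.

Lemma finite_set_injective (T U : Type) (f : T -> U) :
  injective f -> finite_set [set: U] -> finite_set [set: T].
Proof.
by move=> fI fU; rewrite -(preimage_setT f); apply: finite_preimage => // ? ? _ _ /fI.
Qed.

Lemma finite_set_fun (T U : Type) :
  finite_set [set: T] -> finite_set [set: U] -> finite_set [set: T -> U].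
Proof.
move=> /finite_ord_injection[n [e eI]] /finite_ord_injection[m [d dI]].
pose graph (f : T -> U) : {set 'I_n.+1 * 'I_m.+1} :=
  [set p | `[< exists t, e t = p.1 /\ d (f t) = p.2 >]]%SET.
apply: (@finite_set_injective _ _ graph); last exact: finite_finset.
move=> f g fg; apply/funext => t.
have : (e t, d (f t)) \in graph f by rewrite inE; apply/asboolP; exists t.
by rewrite fg inE => /asboolP[s [/= /eI -> /dI]].
Qed.

Lemma finite_setTX (T U : Type) :
  finite_set [set: T] -> finite_set [set: U] -> finite_set [set: T * U].
Proof. by move=> fT fU; rewrite -setXTT; exact: finite_setX. Qed.

Section NormalFiniteIndex.
Variable G : groupType.
Implicit Types (N M : normal_fin_index G) (P : set G).

(** Each fibre of [phi] lies in one coset of [P], so sending a value to the coset of any preimage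
    reaches every coset. *)
Lemma finite_cosets P (T : Type) (phi : G -> T) :
  P 1%g -> (forall x y, P x -> P y -> P (x * y)%g) -> (forall x, P x -> P x^-1%g) ->
  finite_set [set: T] -> (forall g h, phi g = phi h -> P (g^-1 * h)%g) ->
  finite_set (range (left_coset P)).
Proof.
move=> P1 PM PV fT phiP.
have coset_le g h : phi g = phi h -> left_coset P g `<=` left_coset P h.
  move=> /esym/phiP gh _ [u uP <-]; exists (h^-1 * g * u)%g; first exact: PM.
  by rewrite !mulgA mulgV mul1g.
pose psi t := left_coset P
  (if pselect (exists g, phi g = t) is left tP then projT1 (cid tP) else 1%g).
apply: sub_finite_set (finite_image psi fT) => _ [g _ <-]; exists (phi g) => //.
rewrite /psi; case: pselect => [tP|[]]; last by exists g.
by case: cid => h /= hg; apply/seteqP; split; exact: coset_le.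
Qed.

Lemma eq_fin_quot N x y :
  \pi_(fin_quot N)%qT x = \pi_(fin_quot N)%qT y <-> nfi_set N (x^-1 * y)%g.
Proof. by split => [/eqP/same_cosetP//|xy]; apply/eqP/same_cosetP. Qed.

Lemma repr_fin_quot N x : nfi_set N (x^-1 * repr (\pi_(fin_quot N)%qT x))%g.
Proof. by apply/eq_fin_quot; rewrite reprK. Qed.

Lemma finite_fin_quot N : finite_set [set: fin_quot N].
Proof.
have := nfi_finite N; set A := range _ => fA.
pose f (q : fin_quot N) := left_coset N (repr q).
have -> : [set: fin_quot N] = f @^-1` A by apply/seteqP; split=> // q _; exists (repr q).
apply: finite_preimage fA => p q _ _ pq.
have : left_coset N (repr q) (repr p).
  by rewrite -[left_coset _ _]pq; exists 1%g; [exact: nfi1|rewrite mulg1].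
move=> [u Nu up]; rewrite -[p]reprK -[q]reprK; apply/esym/eq_fin_quot.
by rewrite -up mulKg.
Qed.

Lemma nfi_intersection N M : exists P : normal_fin_index G, P `<=` N /\ P `<=` M.
Proof.
pose P : set G := N `&` M.
have P1 : P 1%g by split; exact: nfi1.
have PM x y : P x -> P y -> P (x * y)%g by move=> [? ?] [? ?]; split; exact: nfiM.
have PV x : P x -> P x^-1%g by move=> [? ?]; split; exact: nfiV.
have PJ x g : P x -> P (x ^ g)%g by move=> [? ?]; split; exact: nfiJ.
have Pf : finite_set (range (left_coset P)).
  apply: (@finite_cosets P _ (fun g => (\pi_(fin_quot N)%qT g, \pi_(fin_quot M)%qT g))) => //.
    by apply: finite_setTX; exact: finite_fin_quot.
  by move=> g h [/eq_fin_quot ? /eq_fin_quot].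
by exists (NormalFinIndex P1 PM PV PJ Pf); split => x [].
Qed.

(** Elements that act alike lie in the same coset of the kernel, and a finite [T] has finitely many
    self-maps. *)
Lemma nfi_action_kernel (T : Type) (a : G -> T -> T) :
  finite_set [set: T] -> (forall t, a 1%g t = t) ->
  (forall g h t, a (g * h)%g t = a g (a h t)) ->
  exists N : normal_fin_index G, forall g, nfi_set N g -> forall t, a g t = t.
Proof.
move=> fT a1 aM; pose P : set G := [set g | forall t, a g t = t].
have P1 : P 1%g by [].
have PM x y : P x -> P y -> P (x * y)%g by move=> xP yP t; rewrite aM yP xP.
have PV x : P x -> P x^-1%g by move=> xP t; rewrite -{1}[t]xP -aM mulVg a1.
have PJ x g : P x -> P (x ^ g)%g.
  by move=> xP t; rewrite /conjg !aM xP -aM mulVg a1.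
have Pf : finite_set (range (left_coset P)).
  apply: (@finite_cosets P _ a) => //; first exact: finite_set_fun.
  by move=> g h gh t; rewrite aM -gh -aM mulVg a1.
by exists (NormalFinIndex P1 PM PV PJ Pf).
Qed.

End NormalFiniteIndex.

(** * Retractions of a right-angled Artin group *)

Section WordAction.
Variables (X T : Type) (act : X -> bool -> T -> T).
Hypothesis actK : forall x b t, act x (~~ b) (act x b t) = t.

Definition act_word (t : T) (w : word X) : T := foldl (fun t p => act p.1 p.2 t) t w.

Lemma act_word_cat t v w : act_word t (v ++ w) = act_word (act_word t v) w.
Proof. exact: foldl_cat. Qed.

Lemma act_word_pres_eq (R : set (word X)) v w :
  (forall r t, R r -> act_word t r = t) ->
  pres_eq R v w -> forall t, act_word t v = act_word t w.
Proof.
move=> RP; elim=> {v w} [//|v w _ vw t|u v w _ uv _ vw t|u v x b t|u v r /RP rP t].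
- by rewrite vw.
- by rewrite uv vw.
- by rewrite !act_word_cat /= actK.
- by rewrite !act_word_cat rP.
Qed.

(** Plays the role of the homomorphism from a presented group to the permutations of [T]: [A g] is
    the point reached from [t0] along any word for [g]. *)
Lemma presentation_orbit (G : groupType) (gen : X -> G) (R : set (word X)) (t0 : T) :
  has_presentation gen R -> (forall r t, R r -> act_word t r = t) ->
  exists A : G -> T, A 1%g = t0 /\ forall g x, A (g * gen x)%g = act x true (A g).
Proof.
move=> [evalS evalP] RP; pose W g := projT1 (cid (evalS g)).
have WE g : eval_word gen (W g) = g by rewrite /W; case: cid.
have WP g w : eval_word gen w = g -> act_word t0 (W g) = act_word t0 w.
  by move=> wg; apply: act_word_pres_eq RP _ _; apply/evalP; rewrite WE.
exists (fun g => act_word t0 (W g)); split=> [|g x].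
  by rewrite (WP _ [::])//; exact: big_nil.
rewrite (WP _ (W g ++ [:: (x, true)])) ?act_word_cat//.
by rewrite /eval_word big_cat /= big_seq1 /= -[X in (X * _)%g]/(eval_word gen (W g)) WE.
Qed.

End WordAction.

Section Artin.
Variables (X : finType) (G : groupType) (gen : X -> G) (Sigma : {set X * X}).
Hypothesis GP : has_presentation gen [set commutator_word s.1 s.2 | s in [set` Sigma]].

(** The step is an equivalence because words also contain inverse letters, which use its backward
    direction. *)
Lemma gen_ind (P : G -> Prop) : P 1%g ->
  (forall g x, P g <-> P (g * gen x)%g) -> forall g, P g.
Proof.
move=> P1 PM g; have [w <-] := GP.1 g; elim/last_ind: w => [|w [x b] IH].
  by rewrite /eval_word big_nil.
rewrite /eval_word -cats1 big_cat big_seq1 -/(eval_word gen w) /=.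
case: b; first exact: (PM _ x).1.
by apply: (PM _ x).2; rewrite mulgVK.
Qed.

Lemma gen_commute x y : (x, y) \in Sigma -> (gen x * gen y = gen y * gen x)%g.
Proof.
move=> xy; have : eval_word gen (commutator_word x y) = eval_word gen [::].
  apply/GP.2; rewrite -[commutator_word x y]cats0 -[X in pres_eq _ X _]cat0s.
  by apply: (@pres_eq_relator _ _ [::] [::]); exists (x, y).
rewrite /eval_word big_nil !big_cons big_nil /= mulg1 => e.
apply: (mulgI (gen y)^-1%g); apply: (mulgI (gen x)^-1%g).
by rewrite mulKg mulVg e.
Qed.

Definition gen_in (S : {set X}) x : G := if x \in S then gen x else 1%g.

Lemma gen_in_commute S x y :
  (x, y) \in Sigma -> (gen_in S x * gen_in S y = gen_in S y * gen_in S x)%g.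
Proof.
rewrite /gen_in => xy; case: (x \in S); case: (y \in S) => //.
- exact: gen_commute.
- by rewrite mulg1 mul1g.
- by rewrite mulg1 mul1g.
Qed.

Lemma artin_orbit (T : Type) (a b : X -> T -> T) (t0 : T) :
  (forall x, cancel (a x) (b x)) -> (forall x, cancel (b x) (a x)) ->
  (forall x y t, (x, y) \in Sigma -> a x (a y t) = a y (a x t)) ->
  exists A : G -> T, A 1%g = t0 /\ forall g x, A (g * gen x)%g = a x (A g).
Proof.
move=> aK bK aC.
apply: (@presentation_orbit _ _ (fun x e => if e then a x else b x) _ _ _ _ t0 GP).
  by move=> x [] t /=; rewrite ?aK ?bK.
by move=> _ t [[x y] xy <-]; rewrite /act_word /= -(aC _ _ _ xy) !bK.
Qed.

(** Right multiplication by the letters of [S], the others acting trivially, respects the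
    commutators; [r] is the orbit map of 1. *)
Lemma retraction_exists (S : {set X}) : exists r : G -> G, r 1%g = 1%g /\
  forall g x, r (g * gen x)%g = (r g * gen_in S x)%g.
Proof.
apply: (@artin_orbit _ (fun x g => g * gen_in S x)%g
  (fun x g => g * (gen_in S x)^-1)%g) => [x g|x g|x y g xy].
- by rewrite mulgK.
- by rewrite mulgVK.
- by rewrite -!mulgA (gen_in_commute S xy).
Qed.

Definition retraction S := projT1 (cid (retraction_exists S)).

Lemma retraction1 S : retraction S 1%g = 1%g.
Proof. by rewrite /retraction; case: cid => r []. Qed.

Lemma retraction_mul_gen S g x :
  retraction S (g * gen x)%g = (retraction S g * gen_in S x)%g.
Proof. by rewrite /retraction; case: cid => r []. Qed.

Lemma retraction_gen S x : retraction S (gen x) = gen_in S x.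
Proof. by rewrite -[gen x]mul1g retraction_mul_gen retraction1 mul1g. Qed.

Lemma retractionM S : {morph retraction S : g h / (g * h)%g}.
Proof.
move=> g; apply: gen_ind => [|h x]; first by rewrite retraction1 !mulg1.
rewrite mulgA !retraction_mul_gen mulgA; split=> [->//|].
exact: mulIg.
Qed.

Lemma retractionV S : {morph retraction S : g / g^-1%g}.
Proof.
by move=> g; apply: (mulgI (retraction S g)); rewrite -retractionM !mulgV retraction1.
Qed.

Lemma retraction_eq (f h : G -> G) : f 1%g = h 1%g ->
  (forall g x, exists u, f (g * gen x) = f g * u /\ h (g * gen x) = h g * u)%g -> f =1 h.
Proof.
move=> fh1 fhM; apply: gen_ind => // g x; have [u [-> ->]] := fhM g x.
by split=> [->//|]; exact: mulIg.
Qed.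

Lemma retraction_subl (S T : {set X}) g :
  S \subset T -> retraction S (retraction T g) = retraction S g.
Proof.
move=> ST; move: g; apply: retraction_eq => [|g x]; first by rewrite !retraction1.
exists (gen_in S x); rewrite !retraction_mul_gen retractionM; split=> //; rewrite /gen_in.
case: ifP => xT; first by rewrite retraction_gen.
by rewrite retraction1 (contraFF (fintype.subsetP ST x) xT).
Qed.

Lemma retraction_subr (S T : {set X}) g :
  S \subset T -> retraction T (retraction S g) = retraction S g.
Proof.
move=> ST; move: g; apply: retraction_eq => [|g x]; first by rewrite !retraction1.
exists (gen_in S x); rewrite !retraction_mul_gen retractionM; split=> //; rewrite /gen_in.
case: ifP => xS; last by rewrite retraction1.
by rewrite retraction_gen /gen_in (fintype.subsetP ST).
Qed.

Lemma retractionT g : retraction [set: X]%SET g = g.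
Proof.
move: g; apply: retraction_eq => [|g x]; first by rewrite retraction1.
by exists (gen x); rewrite retraction_mul_gen /gen_in inE.
Qed.

Lemma retraction0 g : retraction finset.set0 g = 1%g.
Proof.
move: g; apply: (@retraction_eq _ (fun=> 1%g)) => [|g x]; first by rewrite retraction1.
by exists 1%g; rewrite retraction_mul_gen /gen_in inE !mulg1.
Qed.

(** [Sigma] may be asymmetric and contain diagonal pairs, so both orders are tested and [x] is
    removed. *)
Definition link (x : X) (S : {set X}) : {set X} :=
  [set y in S :\ x | ((x, y) \in Sigma) || ((y, x) \in Sigma)]%SET.

Lemma link_commute x S g :
  (retraction (link x S) g * gen x = gen x * retraction (link x S) g)%g.
Proof.
move: g; apply: gen_ind => [|g y]; first by rewrite retraction1 mul1g mulg1.
rewrite retraction_mul_gen /gen_in; case: ifP => [|_]; last by rewrite mulg1.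
rewrite inE => /andP[_ /orP yx].
have {}yx : (gen y * gen x = gen x * gen y)%g.
  by case: yx => /gen_commute ->.
rewrite -[(_ * gen y * gen x)%g]mulgA yx !mulgA; split=> [->//|].
exact: mulIg.
Qed.

(* The 1-cochains of the forest with vertices G/<S :\ x> and edges G/<link x S>
   are all coboundaries; the presentation replaces any normal form theorem. *)
Lemma edge_primitive (M : zmodType) (S : {set X}) x (k : G -> M) : x \in S ->
  (forall g y, y \in link x S -> k (g * gen y)%g = k g) ->
  exists l : G -> M, (forall g y, y != x -> l (g * gen y)%g = l g) /\
    forall g, l (g * gen x)%g = l g + k (retraction S g).
Proof.
move=> xS kL; pose s := gen_in S.
(* A state is the retracted position with the running value of [l]: the letter [x] adds [k] at the
   current position, other letters keep the value. *)
pose a y (p : G * M) := ((p.1 * s y)%g, if y == x then p.2 + k p.1 else p.2).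
pose b y (p : G * M) := ((p.1 * (s y)^-1)%g,
  if y == x then p.2 - k (p.1 * (s y)^-1)%g else p.2).
have aC y z p : (y, z) \in Sigma -> a y (a z p) = a z (a y p).
  move=> yz; case: p => p m; rewrite /a /=; congr pair.
    by rewrite -!mulgA /s (gen_in_commute S yz).
  (* A letter related to [x] lies in the link or is killed by the retraction, so it leaves the
     increment [k] unchanged. *)
  have kx w : w != x -> ((x, w) \in Sigma) || ((w, x) \in Sigma) -> k (p * s w)%g = k p.
    move=> wx xw; rewrite /s /gen_in; case: ifP => wS; last by rewrite mulg1.
    by apply: kL; rewrite !inE wx wS.
  case: (eqVneq y x) yz => [->|yx]; case: (eqVneq z x) => [->|zx] yz //; rewrite kx// yz ?orbT//.
have [||//|A [A1 AM]] := @artin_orbit _ a b (1%g, 0).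
- by move=> y [p m]; rewrite /a /b /= mulgK; case: (y == x); rewrite ?addrK.
- by move=> y [p m]; rewrite /a /b /= mulgVK; case: (y == x); rewrite ?subrK.
have A_retraction : (fun g => (A g).1) =1 retraction S.
  apply: retraction_eq => [|g y]; first by rewrite A1 retraction1.
  by exists (s y); rewrite AM retraction_mul_gen.
exists (fun g => (A g).2); split=> [g y /negbTE yx|g]; rewrite AM /= ?yx//.
by rewrite eqxx -A_retraction.
Qed.

End Artin.

(** * Effaceability *)

Section Tuples.
Variable G : groupType.

Definition cons_tuple n (a : G) (x : 'I_n -> G) : 'I_n.+1 -> G :=
  fun i => oapp x a (unlift ord0 i).

Definition translate n (g : G) (x : 'I_n -> G) : 'I_n -> G := fun i => (g * x i)%g.

Lemma cons_tuple0 n a (x : 'I_n -> G) : cons_tuple a x ord0 = a.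
Proof. by rewrite /cons_tuple unlift_none. Qed.

Lemma cons_tuple_lift n a (x : 'I_n -> G) : cons_tuple a x \o lift ord0 = x.
Proof. by apply/funext => i; rewrite /cons_tuple /= liftK. Qed.

Lemma cons_tuple_liftS n a (x : 'I_n.+1 -> G) i :
  cons_tuple a x \o lift (lift ord0 i) = cons_tuple a (x \o lift i).
Proof.
apply/funext => j /=; case: (unliftP ord0 j) => [k ->|->].
  have -> : lift (lift ord0 i) (lift ord0 k) = lift ord0 (lift i k).
    by apply: val_inj; rewrite /= /bump /= !add1n ltnS addnS.
  by rewrite /cons_tuple !liftK.
have -> : lift (lift ord0 i) ord0 = ord0 by apply: val_inj; rewrite /= /bump.
by rewrite !cons_tuple0.
Qed.

Lemma translate_cons n g a (x : 'I_n -> G) :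
  translate g (cons_tuple a x) = cons_tuple (g * a)%g (translate g x).
Proof. by apply/funext => i; rewrite /translate /cons_tuple; case: unliftP. Qed.

Lemma translateM n g h (x : 'I_n -> G) : translate g (translate h x) = translate (g * h)%g x.
Proof. by apply/funext => i; rewrite /translate mulgA. Qed.

Lemma translate1 n (x : 'I_n -> G) : translate 1%g x = x.
Proof. by apply/funext => i; rewrite /translate mul1g. Qed.

End Tuples.

Section Differential.
Variables (G : groupType) (M : gmodule G).

Lemma homog_diff_cons n (f : ('I_n.+2 -> G) -> M) a x :
  homog_diff f (cons_tuple a x) = f x - homog_diff (f \o cons_tuple a) x.
Proof.
rewrite /homog_diff big_ord_recl /= cons_tuple_lift expr0 mulr1z -sumrN.
congr (_ + _); apply: eq_bigr => i _; rewrite cons_tuple_liftS.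
by rewrite /bump /= add1n exprS mulN1r mulrNz.
Qed.

(** The cone with apex [a] is a contracting homotopy. With a fixed apex it is not equivariant in
    general, so later the apex moves with an extra argument. *)
Lemma homog_diff_contract n (f : ('I_n.+2 -> G) -> M) a :
  homog_diff f = 0 -> homog_diff (f \o cons_tuple a) = f.
Proof.
move=> df; apply/funext => x; apply/eqP; rewrite eq_sym -subr_eq0 -homog_diff_cons.
by rewrite df.
Qed.

Lemma homog_diff_deg0 (f : ('I_1 -> G) -> M) x :
  homog_diff f x = f (fun=> x ord_max) - f (fun=> x ord0).
Proof.
rewrite /homog_diff big_ord_recl big_ord1 /= expr0 mulr1z expr1 mulrNz mulr1z.
by congr (f _ - f _); apply/funext => i; rewrite /= !ord1; congr x; exact: val_inj.
Qed.

Lemma homog_diffD n (f h : ('I_n.+1 -> G) -> M) :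
  homog_diff (f + h) = homog_diff f + homog_diff h.
Proof.
rewrite -[f in RHS](addrK h) homog_diffB subrK //.
Qed.

Lemma homog_diff0 n : homog_diff (0 : ('I_n.+1 -> G) -> M) = 0.
Proof. by rewrite -(subrr 0) homog_diffB subrr. Qed.

End Differential.

Section Effaceable.
Variables (G : groupType) (M : gmodule G).
Implicit Types (N : normal_fin_index G) (r : G -> G).

(** Tuples range over all of [G], a free set for the subgroup of fixed points, so they still give a
    resolution for that subgroup, and restricting to a smaller subgroup leaves [F] unchanged. *)
Definition invariant_under r n (F : ('I_n.+1 -> G) -> G -> M) : Prop :=
  forall g x y, r g = g -> F (translate g x) (g * y)%g = F x y.

Definition of_level N n (F : ('I_n.+1 -> G) -> G -> M) : Prop :=
  forall x y u, nfi_set N u -> F x (y * u)%g = F x y.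

(* For H = {g | r g = g}, a function F of level N is an H-cochain with values in
   the functions G/N -> M (M has trivial action here): all cocycles of positive
   degree become coboundaries after enlarging G/N. *)
Definition effaceable r q : Prop :=
  forall N (F : ('I_q.+2 -> G) -> G -> M),
    invariant_under r F -> of_level N F -> (forall y, homog_diff (F^~ y) = 0) ->
  exists N' (H : ('I_q.+1 -> G) -> G -> M),
    [/\ invariant_under r H, of_level N' H & forall y, homog_diff (H^~ y) = F^~ y].

Lemma effaceable_trivial r q : (forall g, r g = 1%g) -> effaceable r q.
Proof.
move=> r1 N F _ FN dF; exists N, (fun x y => F (cons_tuple 1%g x) y); split=> [g x y|x y u Nu|y].
- by rewrite r1 => <-; rewrite translate1 mul1g.
- exact: FN.
- exact: (homog_diff_contract 1%g (dF y)).
Qed.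

(** A 1-cocycle is a crossed homomorphism into functions G/N -> M and gives an action on the finite
    set [fin_quot N * M]. It vanishes on the kernel of this action, which yields a level for the
    cone with apex [r y]. *)
Lemma effaceable_deg0 r : finite_set [set: M] ->
  {morph r : g h / (g * h)%g} -> (forall g, r (r g) = r g) -> effaceable r 0.
Proof.
move=> fM rM rr N F FH FN dF.
have r1 : r 1%g = 1%g by apply: (mulgI (r 1%g)); rewrite -rM !mulg1.
pose F2 a b y := F (cons_tuple a (fun=> b)) y.
have F2D a b c y : F2 a c y = F2 a b y + F2 b c y.
  have := congr1 (fun f => f (cons_tuple a (cons_tuple b (fun=> c)))) (dF y).
  rewrite /= homog_diff_cons homog_diff_deg0 /= cons_tuple0 /F2.
  have -> : cons_tuple b (fun=> c : G) (ord_max : 'I_2) = c.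
    have <- : lift ord0 ord0 = ord_max :> 'I_2 by exact: val_inj.
    by rewrite /cons_tuple liftK.
  by move=> /eqP; rewrite subr_eq0 => /eqP ->; rewrite addrC subrK.
have F2J g a b y : r g = g -> F2 (g * a)%g (g * b)%g (g * y)%g = F2 a b y.
  by move=> gH; have := FH g (cons_tuple a (fun=> b)) y gH; rewrite translate_cons.
have F2N a b y z : \pi_(fin_quot N)%qT y = \pi_(fin_quot N)%qT z -> F2 a b y = F2 a b z.
  by move=> /eq_fin_quot yz; rewrite -[z](mulVKg y) /F2 FN.
pose act g (p : fin_quot N * M) : fin_quot N * M :=
  ((\pi_(fin_quot N)%qT (r g) * p.1)%g, p.2 + F2 1%g (r g)^-1%g (repr p.1)).
have F20 a y : F2 a a y = 0 by apply: (addrI (F2 a a y)); rewrite -F2D addr0.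
have [|||K KP] := @nfi_action_kernel G _ act.
- by apply: finite_setTX => //; exact: finite_fin_quot.
- by move=> [q m]; rewrite /act r1 invg1 F20 fin_quot_pi1 mul1g addr0.
- move=> g h [q m]; rewrite /act /= rM fin_quot_piM mulgA; congr pair.
  rewrite -addrA; congr (_ + _); rewrite (F2D _ (r h)^-1%g) invgM; congr (_ + _).
  rewrite -[LHS](F2J (r h)) // mulgV mulVKg; apply: F2N.
  by rewrite fin_quot_piM !reprK.
have [N' [N'K N'N]] := nfi_intersection K N.
exists N', (fun x y => F (cons_tuple (r y) x) y); split=> [g x y gH|x y u N'u|y].
- by rewrite rM gH -translate_cons FH.
- rewrite rM FN; last exact: N'N.
  have -> : x = fun=> x ord0 by apply/funext => i; rewrite ord1.
  rewrite -/(F2 _ _ _) -/(F2 (r y) _ _) (F2D _ (r y)) -[RHS]add0r; congr (_ + _).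
  (* The second component, translated by [r (y * u)], says that [F2] vanishes from [r (y * u)] to
     [r y], so both apexes give the same cone. *)
  have := KP _ (N'K _ N'u) (\pi_(fin_quot N)%qT ((r (y * u))^-1 * y)%g, 0).
  move=> [_]; rewrite add0r.
  rewrite (F2N _ _ _ ((r (y * u))^-1 * y)%g) ?reprK//.
  by rewrite -[LHS](F2J (r (y * u)%g)) // rM mulg1 mulgK mulVKg.
- exact: homog_diff_contract.
Qed.

End Effaceable.

(** * Effaceability for right-angled Artin groups, by induction on the generators *)

Section ArtinEffaceable.
Variables (X : finType) (G : groupType) (gen : X -> G) (Sigma : {set X * X}).
Hypothesis GP : has_presentation gen [set commutator_word s.1 s.2 | s in [set` Sigma]].
Variable M : gmodule G.

Local Notation ret := (retraction GP).

(** A Mayer-Vietoris argument on cochains. Each vertex gets a primitive [H] of [F]; its jump across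
    an edge is a cocycle of the edge group with primitive [P]; a function [Q] on vertices with jumps
    [P] corrects [H] to H - dQ, which is the same at all vertices. *)
Lemma effaceable_step (S : {set X}) x q : x \in S ->
  effaceable M (ret (S :\ x)%SET) q.+1 -> effaceable M (ret (link Sigma x S)) q ->
  effaceable M (ret S) q.+1.
Proof.
move=> xS effD effL N F FH FN dF.
have DS : (S :\ x)%SET \subset S by exact: subD1set.
have LD : link Sigma x S \subset (S :\ x)%SET.
  by apply/fintype.subsetP => y; rewrite !inE => /andP[].
have LS := fintype.subset_trans LD DS.
set r := ret S; pose r' := ret (S :\ x)%SET; pose rL := ret (link Sigma x S).
have r'_r g : r' g = g -> r g = g.
  by move=> g'; rewrite -g' /r retraction_subr.
have rL_r' g : rL g = g -> r' g = g.
  by move=> gL; rewrite -gL /r' retraction_subr.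
have r_idem g : r (r g) = r g by rewrite /r retraction_subr.
have [|N1 [H0 [H0J H0N dH0]]] := effD N F _ FN dF.
  by move=> g ? ? /r'_r; exact: FH.
(* n v represents the vertex v<S :\ x> and only depends on that vertex. *)
pose n v := (r v * (r' v)^-1)%g.
have n1 : n 1%g = 1%g by rewrite /n /r /r' !retraction1 mulgV.
have nM v y : y != x -> n (v * gen y)%g = n v.
  move=> yx; rewrite /n /r /r' !retraction_mul_gen /gen_in !inE yx /=.
  by rewrite invgM mulgA mulgK.
have nr v : n (r v) = n v by rewrite /n r_idem /r' /r retraction_subl.
have nJ g v : r g = g -> n (g * v)%g = (g * n v * (r' g)^-1)%g.
  by move=> gH; rewrite /n /r /r' !retractionM -/r -/r' gH invgM !mulgA.
have nL v u : rL u = u -> n (v * u)%g = n v.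
  move=> /rL_r' uD; rewrite /n /r /r' !retractionM -/r -/r' uD (r'_r _ uD).
  by rewrite invgM mulgA mulgK.
have n_fix v : r (n v) = n v.
  by rewrite /n {1}/r retractionM -/r r_idem /r retractionV retraction_subr.
clearbody n.
(* [H0] is transported to the vertex of [v]. By [nJ], moving [v] by [g] multiplies [n v] by [g] up
   to a right factor in the group of [S :\ x], which the invariance of [H0] absorbs. *)
pose H x y v := H0 (translate (n v)^-1%g x) ((n v)^-1 * y)%g.
have Hn z y v w : n v = n w -> H z y v = H z y w by rewrite /H => ->.
have HJ g z y v : r g = g -> H (translate g z) (g * y)%g (g * v)%g = H z y v.
  move=> gH; rewrite /H (nJ _ _ gH) !invgM invgK !mulgA !translateM !mulgVK.
  rewrite -(H0J (r' g) (translate (n v)^-1%g z)) ?translateM ?mulgA//.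
  by rewrite /r' retraction_subr.
have HN z y u v : nfi_set N1 u -> H z (y * u)%g v = H z y v.
  by move=> uN; rewrite /H mulgA H0N.
have dH y v : homog_diff (fun x => H x y v) = F^~ y.
  apply/funext => z; have /(congr1 (fun f => f (translate (n v)^-1%g z))) := dH0 ((n v)^-1 * y)%g.
  move=> /= e; rewrite -[LHS]/(homog_diff (H0^~ ((n v)^-1 * y)%g) (translate (n v)^-1%g z)) e FH//.
  by rewrite /r retractionV -/r n_fix.
pose t := gen x; have rt : r t = t by rewrite /r retraction_gen /gen_in xS.
have HL z y v u : rL u = u -> H z y (u * t * v)%g = H z y (t * u * v)%g.
  by move=> uL; rewrite /t -{1}uL /rL link_commute -/rL uL.
(* The edge at 1 joins the vertices of 1 and [t]. Both values of [H] are primitives of [F], so the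
   jump is a cocycle; the link group fixes both ends because it commutes with [t]. *)
have [|||N2 [P0 [P0J P0N dP0]]] := effL N1 (fun x y => H x y t - H x y 1%g).
- move=> g z y gL; have gH := r'_r _ (rL_r' _ gL); rewrite -/rL in gL.
  have gVL : rL g^-1%g = g^-1%g by rewrite /rL retractionV -/rL gL.
  have HgV v : H (translate g z) (g * y)%g v = H z y (g^-1 * v)%g.
    by rewrite -[RHS](HJ g) ?mulVKg.
  rewrite !HgV mulg1; congr (_ - _); last by rewrite -[(g^-1)%g]mul1g; exact/Hn/nL.
  by rewrite -[(g^-1 * t)%g]mulg1 HL // mulg1; exact/Hn/nL.
- by move=> z y u uN; rewrite !HN.
- by move=> y; rewrite -[X in homog_diff X]/((fun x => H x y t) - (fun x => H x y 1%g))
    homog_diffB !dH subrr.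
(* Translation by [r v] spreads [P0] from the edge at 1 to all edges. *)
pose P z y v := P0 (translate (r v)^-1%g z) ((r v)^-1 * y)%g.
have PJ g z y v : r g = g -> P (translate g z) (g * y)%g (g * v)%g = P z y v.
  move=> gH; rewrite /P {1 2}/r retractionM -/r gH !invgM translateM mulgA.
  by rewrite mulgVK.
have Pr z y v : P z y (r v) = P z y v by rewrite /P r_idem.
have dP y v : homog_diff (fun z => P z y v) = (fun z => H z y (v * t)%g - H z y v).
  apply/funext => z.
  have /(congr1 (fun f => f (translate (r v)^-1%g z))) := dP0 ((r v)^-1 * y)%g.
  move=> /= e; rewrite -[LHS]/(homog_diff (P0^~ ((r v)^-1 * y)%g) (translate (r v)^-1%g z)) e.
  have HrV w : H (translate (r v)^-1%g z) ((r v)^-1 * y)%g w = H z y (r v * w)%g.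
    by rewrite -[LHS](HJ (r v)) // translateM mulgV translate1 mulVKg.
  by rewrite !HrV mulg1; congr (_ - _); apply: Hn; rewrite ?nr // -{1}rt /r -retractionM nr.
pose prim z y : set (G -> M) := [set l | (forall g w, w != x -> l (g * gen w)%g = l g) /\
  forall g, l (g * t)%g = l g + P z y (r g)].
pose Q1 z y := xget 0 (prim z y).
have Q1P z y : prim z y (Q1 z y).
  apply: xgetPex; apply: edge_primitive => // g w wL.
  have wS : w \in S by rewrite (fintype.subsetP LS).
  rewrite /P {1 2}/r retraction_mul_gen /gen_in wS -/r !invgM -translateM -mulgA.
  apply: P0J; rewrite -/rL /rL retractionV retraction_gen /gen_in wL //.
(* The choice [Q1] need not be equivariant. Moving the tuple so that its first entry retracts to 1
   before choosing makes [Q] equivariant, as [s] commutes with translation by G_S. *)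
pose s (z : 'I_q.+1 -> G) := r (z ord0).
pose Q z y v := Q1 (translate (s z)^-1%g z) ((s z)^-1 * y)%g ((s z)^-1 * v)%g.
have sV z : r (s z)^-1%g = (s z)^-1%g by rewrite /r retractionV -/r r_idem.
have Qgen z y v w : w != x -> Q z y (v * gen w)%g = Q z y v.
  by move=> wx; rewrite /Q mulgA (Q1P _ _).1.
have Qt z y v : Q z y (v * t)%g = Q z y v + P z y v.
  by rewrite /Q mulgA (Q1P _ _).2 Pr PJ.
have QJ g z y v : r g = g -> Q (translate g z) (g * y)%g (g * v)%g = Q z y v.
  move=> gH; have sg : s (translate g z) = (g * s z)%g.
    by rewrite /s /translate {1}/r retractionM -/r gH.
  by rewrite /Q sg !invgM translateM !mulgA mulgVK.
have QN z y u v : nfi_set N2 u -> Q z (y * u)%g v = Q z y v.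
  (* [xget] chooses equal elements from equal sets, so the level of [P0] survives the choice. *)
  move=> uN; rewrite /Q /Q1; congr (xget _ _ _); rewrite /prim; apply/seteqP.
  by split=> l [lx lt]; split=> // g; rewrite lt /P !mulgA (P0N _ _ _ uN).
(* Across the letter [x] both terms change by dP; across any other letter neither changes. Being
   constant in [v], [H'] inherits invariance at [v] = 1. *)
pose H' z y v := H z y v - homog_diff (fun z => Q z y v) z.
have H'gen z y v w : H' z y (v * gen w)%g = H' z y v.
  case: (eqVneq w x) => [->|wx]; last first.
    rewrite /H' (Hn _ _ _ v) ?nM//; congr (_ - homog_diff _ _).
    by apply/funext => ?; rewrite Qgen.
  rewrite /H'.
  have -> : (fun z => Q z y (v * gen x)%g) = (fun z => Q z y v) + (fun z => P z y v).
    by apply/funext => ?; rewrite Qt.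
  by rewrite homog_diffD dP !fctE opprD opprB addrCA subrKC addrC.
have H'1 z y v : H' z y v = H' z y 1%g.
  by move: v; apply: (gen_ind GP) => // v w; rewrite H'gen.
have [N3 [N31 N32]] := nfi_intersection N1 N2.
exists N3, (fun z y => H' z y 1%g); split=> [g z y gH|z y u uN|y].
- rewrite -(H'1 _ _ (g * 1)%g) /H' HJ//; congr (_ - _).
  rewrite -[LHS]/(homog_diff (fun z => Q (translate g z) (g * y)%g (g * 1)%g) z).
  by congr (homog_diff _ _); apply/funext => ?; rewrite /= QJ.
- rewrite /H' HN; last exact: N31.
  by congr (_ - homog_diff _ _); apply/funext => ?; rewrite QN//; exact: N32.
- rewrite -[X in homog_diff X]/((fun z => H z y 1%g) - homog_diff (fun z => Q z y 1%g)).
  by rewrite homog_diffB dH homog_diff_diff subr0.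
Qed.

(** The induction on the size of [S] keeps the degree arbitrary: deleting [x] needs the same degree,
    the link one degree less. *)
Lemma effaceable_retraction (S : {set X}) q : finite_set [set: M] -> effaceable M (ret S) q.
Proof.
move=> fM; have [k] := ubnP #|S|; elim: k S q => // k IH S q Sk.
have [->|[x xS]] := set_0Vmem S; first exact/effaceable_trivial/retraction0.
have Dk : (#|(S :\ x)%SET| < k)%N by move: Sk; rewrite (cardsD1 x S) xS.
case: q => [|q].
  apply: effaceable_deg0 => // [|g]; first exact: retractionM.
  by rewrite retraction_subr.
apply: (effaceable_step xS); apply: IH => //.
apply: leq_ltn_trans Dk; apply/subset_leq_card/fintype.subsetP => y.
by rewrite !inE => /andP[].
Qed.

End ArtinEffaceable.

(** * Dimension shifting *)

Section DifferenceModule.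
Variables (G : groupType) (M : gmodule G) (N : normal_fin_index G).

Definition is_difference : {pred G -> G -> M} := fun b =>
  `[< (forall y z u v, nfi_set N u -> nfi_set N v -> b (y * u)%g (z * v)%g = b y z) /\
      (forall x y z, b x y + b y z = b x z) >].

Fact difference_zmod_closed : zmod_closed is_difference.
Proof.
split=> [|b c]; rewrite !unfold_in.
  by apply/asboolP; split=> // *; exact: addr0.
move=> /asboolP[bN bD] /asboolP[cN cD]; have bcE y z : (b - c) y z = b y z - c y z by [].
apply/asboolP; split=> [y z u v uN vN|x y z]; rewrite !bcE; first by rewrite bN// cN.
by rewrite addrACA -opprD bD cD.
Qed.

HB.instance Definition _ :=
  GRing.isZmodClosed.Build (G -> G -> M) is_difference difference_zmod_closed.

(* The quotient of the coinduced module Map(G/N, M) by the constants: the class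
   of a is represented by (y, z) |-> a z - a y. *)
Record difference := Difference { diff_fun :> G -> G -> M; _ : diff_fun \in is_difference }.
HB.instance Definition _ := [isSub for diff_fun].
HB.instance Definition _ := [Choice of difference by <:].
HB.instance Definition _ := [SubChoice_isSubZmodule of difference by <:].

Lemma difference_level (b : difference) y z u v : nfi_set N u -> nfi_set N v ->
  b (y * u)%g (z * v)%g = b y z.
Proof. by case: b => b /= /asboolP[bN _]; exact: bN. Qed.

Lemma differenceD (b : difference) x y z : b x y + b y z = b x z.
Proof. by case: b => b /= /asboolP[_]; exact. Qed.

Lemma difference_ext (b c : difference) : (forall y z, b y z = c y z) -> b = c.
Proof. by move=> bc; apply: val_inj; apply/funext => y; apply/funext => z; exact: bc. Qed.

Fact difference_act_subproof (g : G) (b : difference) :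
  (fun y z => gact g (b (g^-1 * y)%g (g^-1 * z)%g)) \in is_difference.
Proof.
apply/asboolP; split=> [y z u v uN vN|x y z]; first by rewrite !mulgA difference_level.
by rewrite -gactD differenceD.
Qed.

Definition difference_act g b := Difference (difference_act_subproof g b).

Fact difference_act1 b : difference_act 1%g b = b.
Proof. by apply: difference_ext => y z /=; rewrite gact1 invg1 !mul1g. Qed.

Fact difference_actM g h b :
  difference_act (g * h)%g b = difference_act g (difference_act h b).
Proof. by apply: difference_ext => y z /=; rewrite gactM invgM !mulgA. Qed.

Fact difference_actD g b c :
  difference_act g (b + c) = difference_act g b + difference_act g c.
Proof. by apply: difference_ext => y z; rewrite /= gactD. Qed.

Definition difference_module : gmodule G :=
  GModule difference_act1 difference_actM difference_actD.

Lemma finite_difference_module : finite_set [set: M] -> finite_set [set: difference_module].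
Proof.
move=> fM; pose f (b : difference) (p q : fin_quot N) : M := b (repr p) (repr q).
apply: (@finite_set_injective _ _ f).
  move=> b c bc; apply: difference_ext => y z.
  have := congr1 (fun f => f (\pi_(fin_quot N)%qT y) (\pi_(fin_quot N)%qT z)) bc.
  have e w : repr (\pi_(fin_quot N)%qT w) = (w * (w^-1 * repr (\pi_(fin_quot N)%qT w)))%g.
    by rewrite mulVKg.
  by rewrite /f (e y) (e z) !difference_level //; exact: repr_fin_quot.
by apply: finite_set_fun; [|apply: finite_set_fun] => //; exact: finite_fin_quot.
Qed.

Fact difference_evalB y z : zmod_morphism (fun b : difference => b y z).
Proof. by []. Qed.

Definition difference_eval y z : difference_module -> M := fun b => b y z.

HB.instance Definition _ y z :=
  GRing.isZmodMorphism.Build difference_module M (difference_eval y z) (difference_evalB y z).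

End DifferenceModule.

(** * Finitary cochains and their acyclic quotient *)

Section Finitary.
Variable G : groupType.
Implicit Types (M : gmodule G) (N : normal_fin_index G).

Lemma homog_diff_additive M M' (phi : {additive M -> M'}) n (f : ('I_n.+1 -> G) -> M) :
  homog_diff (phi \o f) = phi \o homog_diff f.
Proof.
apply/funext => x; rewrite /homog_diff /= raddf_sum; apply: eq_bigr => i _.
by rewrite raddfMz.
Qed.

Definition finitary_at M N n (f : ('I_n.+1 -> G) -> M) : Prop :=
  forall x u, (forall i, nfi_set N (u i)) -> f (fun i => x i * u i)%g = f x.

Definition finitary M n (f : ('I_n.+1 -> G) -> M) : Prop := exists N, finitary_at N f.

Definition homog_coboundary M n : (('I_n.+1 -> G) -> M) -> Prop :=
  match n with
  | 0 => fun f => f = 0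
  | n'.+1 => fun f => exists2 e, equivariant e & f = homog_diff (e : ('I_n'.+1 -> G) -> M)
  end.

Lemma finitary_at_diff M N n (f : ('I_n.+1 -> G) -> M) :
  finitary_at N f -> finitary_at N (homog_diff f).
Proof.
move=> fN x u uN; apply: eq_bigr => i _; congr (_ *~ _).
exact: (fN (x \o lift i) (u \o lift i) (fun j => uN (lift i j))).
Qed.

Lemma finitary_at_cons M N n (f : ('I_n.+2 -> G) -> M) x y (u : 'I_n.+1 -> G) v :
  finitary_at N f -> nfi_set N v -> (forall i, nfi_set N (u i)) ->
  f (cons_tuple (y * v)%g (fun i => x i * u i)%g) = f (cons_tuple y x).
Proof.
move=> fN vN uN; rewrite -(fN (cons_tuple y x) (cons_tuple v u)).
  by congr f; apply/funext => i; rewrite /cons_tuple; case: unliftP.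
by move=> i; rewrite /cons_tuple; case: unliftP => [j|] _ /=.
Qed.

Lemma finite_action_level M : finite_set [set: M] ->
  exists N, forall g, nfi_set N g -> forall a : M, gact g a = a.
Proof.
by move=> fM; apply: (nfi_action_kernel fM) => [|g h] a; [exact: gact1|exact: gactM].
Qed.

(** In positive degree, [e x] is represented by the function [e x (x ord0)], which vanishes at the
    first entry. This normalisation is equivariant, so the coboundary of the representatives is an
    equivariant cocycle lifting [b]. *)
Lemma difference_coboundary_lift M N n (b : ('I_n.+1 -> G) -> difference_module M N) :
  homog_coboundary b ->
  exists w : ('I_n.+1 -> G) -> G -> M,
    [/\ forall a x y, w (translate a x) (a * y)%g = gact a (w x y),
        forall y, homog_diff (w^~ y) = 0 &
        forall x y z, w x z - w x y = b x y z].
Proof.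
case: n b => [|n] b /= => [->|[e eE ->]].
  exists (fun _ _ => 0); split=> [a x y|y|x y z]; last exact: subrr.
    by rewrite raddf0.
  exact: homog_diff0.
exists (fun x y => homog_diff (fun x => e x (x ord0) y) x); split=> [a x y|y|x y z].
- rewrite /homog_diff raddf_sum; apply: eq_bigr => i _; rewrite raddfMz; congr (_ *~ _).
  rewrite -[(translate a x \o lift i)]/(translate a (x \o lift i)) eE /=.
  by rewrite /translate /= !mulKg.
- exact: homog_diff_diff.
- rewrite -[RHS]/((difference_eval y z \o homog_diff (e : _ -> difference_module M N)) x)
    -homog_diff_additive.
  rewrite -[LHS]/((homog_diff (fun x => e x (x ord0) z) -
    homog_diff (fun x => e x (x ord0) y)) x) -homog_diffB.
  congr (homog_diff _ x); apply/funext => v; rewrite !fctE /difference_eval /=.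
  by rewrite -(differenceD (e v) (v ord0) y z) addrAC subrr add0r.
Qed.

Hypothesis G_effaceable : forall M q, finite_set [set: M] -> effaceable M id q.

(* Cochains modulo finitary cochains form an acyclic complex. *)
Lemma finitary_decomposition n M (f : ('I_n.+1 -> G) -> M) : finite_set [set: M] ->
  equivariant f -> finitary (homog_diff f) ->
  exists k, [/\ equivariant k, finitary k & homog_coboundary (f - k)].
Proof.
elim: n M f => [|n IH] M f fM fE [N dfN]; have [N0 N0P] := finite_action_level fM.
  (* In degree 0, [f] is determined by its value at 1 and the action, so a subgroup acting trivially
     on [M] is a level for [f]. *)
  exists f; split; rewrite ?subrr//; exists N0 => x u uN.
  have fx z : f z = gact (z ord0) (f (fun=> 1%g)).
    by rewrite -fE; congr f; apply/funext => i; rewrite ord1 mulg1.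
  by rewrite [LHS]fx [RHS]fx gactM (N0P (u ord0)).
set g := homog_diff f in dfN; have dg : homog_diff g = 0 by exact: homog_diff_diff.
have gE : equivariant g by exact: homog_diff_equivariant.
(* The constant function [f x] minus the cone of [g] with apex [y] is a cocycle in functions of [y];
   it has a level in [y] even if [f] is not finitary. *)
pose u x y := f x - g (cons_tuple y x).
have du y : homog_diff (u^~ y) = 0.
  rewrite -[u^~ y]/(f - (g \o cons_tuple y)) homog_diffB homog_diff_contract//.
  by rewrite subrr.
have uE a x y : u (translate a x) (a * y)%g = gact a (u x y).
  by rewrite /u -translate_cons fE gE gactB.
have [N1 [N1N N1N0]] := nfi_intersection N N0.
have gactN1 y v a : nfi_set N1 v -> gact (y * v)%g a = gact y a :> M.
  by move=> vN; rewrite gactM (N0P v)//; exact: N1N0.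
(* Acting by the inverse of [y] turns equivariance into the invariance used in effaceability, where
   [M] carries the trivial action. *)
have [|||N2 [H [HJ HN dH]]] := @G_effaceable M n fM N1 (fun x y => gact y^-1%g (u x y)).
- by move=> a x y _; rewrite uE -gactM invgM mulgVK.
- move=> x y v vN; rewrite invgM gactM N0P; last exact/nfiV/N1N0.
  congr gact; rewrite /u; congr (_ - _).
  rewrite -[in RHS](finitary_at_cons x y (u := fun=> 1%g) dfN (N1N _ vN)).
    by congr (g (cons_tuple _ _)); apply/funext => i; rewrite mulg1.
  by move=> i; exact: nfi1.
- move=> y; rewrite -[X in homog_diff X]/(gact y^-1%g \o (u^~ y)) homog_diff_additive du.
  by apply/funext => x; exact: raddf0.
have [N3 [N31 N32]] := nfi_intersection N1 N2.
pose h x y := gact y (H x y).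
have hE a x y : h (translate a x) (a * y)%g = gact a (h x y) by rewrite /h HJ// gactM.
have hN x y v : nfi_set N3 v -> h x (y * v)%g = h x y.
  by move=> vN; rewrite /h gactN1 ?HN//; [exact: N32|exact: N31].
have dh y : homog_diff (h^~ y) = u^~ y.
  rewrite -[h^~ y]/(gact y \o (H^~ y)) homog_diff_additive dH.
  by apply/funext => x; rewrite /= -gactM mulgV gact1.
have hbarP x : (fun y z => h x z - h x y) \in @is_difference _ M N3.
  apply/asboolP; split=> [y z v w vN wN|w y z]; first by rewrite !hN.
  by rewrite addrC subrKA.
(* Modulo constants the term [f x] of [u] cancels, so the coboundary of [hbar] is finitary and the
   induction hypothesis applies to the difference module. *)
pose hbar x : difference_module M N3 := Difference (hbarP x).
have hbarE : equivariant hbar.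
  move=> a x; apply: difference_ext => y z /=.
  have ha w : h (translate a x) w = gact a (h x (a^-1 * w)%g) by rewrite -hE mulVKg.
  by rewrite -/(translate a x) !ha gactB.
have dhbar x y z : homog_diff hbar x y z = u x z - u x y.
  rewrite -[LHS]/((difference_eval y z \o homog_diff hbar) x) -homog_diff_additive.
  rewrite -[X in homog_diff X]/(h^~ z - h^~ y) homog_diffB !dh //.
have [|kbar [kbarE [N4 kbarN] kbarB]] := IH _ hbar (finite_difference_module _ fM) hbarE.
  exists N => x v vN; apply: difference_ext => y z; rewrite !dhbar /u.
  have gv w : g (cons_tuple w (fun i => x i * v i)%g) = g (cons_tuple w x).
    by rewrite -{1}[w]mulg1; apply: finitary_at_cons dfN _ vN; exact: nfi1.
  by rewrite !gv !opprD !opprK addrACA subrr add0r [RHS]addrACA subrr add0r.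
have [w [wE dw wB]] := difference_coboundary_lift kbarB.
pose k x y := kbar x (x ord0) y.
have kE a x y : k (translate a x) (a * y)%g = gact a (k x y).
  by rewrite /k kbarE /= !mulKg.
(* Modulo constants [m] is hbar - (hbar - kbar) - kbar = 0, so it is independent of [y] and is a
   cochain with values in [M]. *)
pose m x y := h x y - w x y - k x y.
have mE a x y : m (translate a x) (a * y)%g = gact a (m x y).
  by rewrite /m hE wE kE -!gactB.
have m_const x y z : m x y = m x z.
  apply/eqP; rewrite eq_sym -subr_eq0; apply/eqP; rewrite /m.
  have -> : h x z - w x z - k x z - (h x y - w x y - k x y) =
      (h x z - h x y) - (w x z - w x y) - (k x z - k x y).
    by rewrite !opprD !opprK [LHS]addrACA; congr (_ + _); exact: addrACA.
  rewrite wB -[h x z - h x y]/(hbar x y z) /k.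
  rewrite -(differenceD (kbar x) (x ord0) y z) [_ + kbar x y z]addrC addrK.
  rewrite -[(hbar - kbar) x y z]/(hbar x y z - kbar x y z).
  by rewrite opprB subrKC subrr.
have m1E : equivariant (m^~ 1%g).
  by move=> a x; rewrite -mE mulg1; exact: m_const.
have [N5 [N53 N54]] := nfi_intersection N3 N4.
(* As dh = u and dw = 0, this is the cone of [g] with apex 1 plus dk at 1, both finitary. *)
exists (f - homog_diff (m^~ 1%g)); split.
- by move=> a x; rewrite !fctE fE homog_diff_equivariant// gactB.
- exists N5 => x v vN.
  have -> : f - homog_diff (m^~ 1%g) = (g \o cons_tuple 1%g) + homog_diff (k^~ 1%g).
    rewrite -[m^~ 1%g]/(h^~ 1%g - w^~ 1%g - k^~ 1%g) !homog_diffB dh dw subr0.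
    by apply/funext => z; rewrite !fctE /u !opprD !opprK addrA addNKr.
  rewrite !fctE; congr (_ + _).
    rewrite /= -{1}[1%g]mulg1; apply: finitary_at_cons dfN _ _; first exact: nfi1.
    by move=> i; apply/N1N/N31/N53.
  apply: finitary_at_diff vN => z {}v vN; rewrite /k kbarN => [|i]; last exact/N54.
  by rewrite -{1}[1%g]mulg1 difference_level//; [exact: N53|exact: nfi1].
- exists (m^~ 1%g) => //; by rewrite opprB addrC subrK.
Qed.

End Finitary.

(** * Topology of the profinite completion *)

Section ProfiniteTopology.
Variable G : groupType.
Local Notation Ghat := (profinite_completion G).
Local Notation tuples n := (prod_topology (fun _ : 'I_n => Ghat)).

Lemma initial_cvg (S : choiceType) (T : topologicalType) (f : S -> T)
    (F : set_system S) (s : S) : Filter F ->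
  f @ F --> f s -> F --> (s : initial_topology f).
Proof.
move=> FF fs A [B [[O oO <-] Os] BA]; apply: filterS BA _; apply: fs.
exact: open_nbhs_nbhs.
Qed.

Lemma pc_cvg (F : set_system Ghat) (z : Ghat) : Filter F ->
  (forall N, F [set w | pc_coord w N = pc_coord z N]) -> F --> z.
Proof.
move=> FF Fz; apply: initial_cvg; apply/cvg_sup => N; apply: initial_cvg.
exact/(@discrete_cvg (discrete_topology (fin_quot N)))/Fz.
Qed.

Definition cylinder n (z : 'I_n -> Ghat) (N : normal_fin_index G) : set ('I_n -> Ghat) :=
  [set w | forall i, pc_coord (w i) N = pc_coord (z i) N].

Lemma cylinder_sub n (z : 'I_n -> Ghat) (N M : normal_fin_index G) :
  N `<=` M -> cylinder z N `<=` cylinder z M.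
Proof. by move=> NM w wz i; rewrite -!(pc_coordP _ NM) wz. Qed.

Lemma nfi_inhabited : exists N : normal_fin_index G, True.
Proof.
have [|//|//|N _] := @nfi_action_kernel G unit (fun _ t => t); last by exists N.
exact: finite_finset.
Qed.

Lemma tuples_cvg n (F : set_system ('I_n -> Ghat)) (z : 'I_n -> Ghat) : Filter F ->
  (forall i N, F [set w | pc_coord (w i) N = pc_coord (z i) N]) -> F --> (z : tuples n).
Proof.
by move=> FF Fz; apply/cvg_sup => i; apply: initial_cvg; apply: pc_cvg => N; exact: Fz.
Qed.

Lemma tuples_nbhsP n (z : 'I_n -> Ghat) (U : set ('I_n -> Ghat)) :
  nbhs (z : tuples n) U <-> exists N, cylinder z N `<=` U.
Proof.
split=> [zU|[N NU]].
  (* The filter generated by the cylinders at [z] converges to [z], so every neighbourhood contains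
     a cylinder. *)
  have FF : Filter (filter_from [set: normal_fin_index G] (cylinder z)).
    apply: filter_fromT_filter => [|N M]; first exact: nfi_inhabited.
    have [P [PN PM]] := nfi_intersection N M; exists P => w wP.
    by split; [exact: (cylinder_sub PN)|exact: (cylinder_sub PM)].
  have [|N _ NU] := @tuples_cvg n _ z FF _ U zU; last by exists N.
  by move=> i N; exists N => // w; exact.
apply: (@filterS (tuples n) (nbhs (z : tuples n)) _ _ _ NU).
have := @filter_forall (tuples n) 'I_n (fun i w => pc_coord (w i) N = pc_coord (z i) N)
  (nbhs (z : tuples n)) _; apply => i.
have coordN := (discrete_continuousP _).1 (@pc_coord_continuous G N) (z i).
exact: (@proj_continuous _ (fun=> Ghat) i z _ coordN).
Qed.

Lemma pc_nbhs (z : Ghat) (U : set Ghat) : nbhs z U ->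
  exists N, forall w, pc_coord w N = pc_coord z N -> U w.
Proof.
move=> zU; have : nbhs ((fun=> z) : tuples 1) [set w | U (w ord0)].
  exact: (@proj_continuous _ (fun _ : 'I_1 => Ghat) ord0 (fun=> z) _ zU).
by move=> /tuples_nbhsP[N NU]; exists N => w wz; apply: (NU (fun=> w)).
Qed.

Lemma ultra_finite (T U : Type) (F : set_system T) (f : T -> U) :
  UltraFilter F -> finite_set [set: U] -> exists u, F [set t | f t = u].
Proof.
move=> FU /finite_ord_injection[n [e eI]]; apply: contrapT => nF.
have /(@filter_forall _ 'I_n.+1 (fun i t => e (f t) <> i) F _) /filter_ex[t /(_ (e (f t)))]// :
    forall i, \forall t \near F, e (f t) <> i.
move=> i; have [[u ui]|nui] := pselect (exists u, e u = i); last first.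
  by apply: filterE => t fti; apply: nui; exists (f t).
have [Fu|] := in_ultra_setVsetC [set t | f t = u] FU; first by case: nF; exists u.
by apply: filterS => t ftu; rewrite -ui => /eI.
Qed.

(** An ultrafilter fixes each coordinate in each finite quotient. These values are compatible
    because two members of the filter meet, and they form its limit. *)
Lemma tuples_compact n : compact [set: tuples n].
Proof.
rewrite compact_ultra => F FU _.
have coordF i N : exists q, F [set w : 'I_n -> Ghat | pc_coord (w i) N = q].
  exact: ultra_finite FU (finite_fin_quot N).
pose c i N := projT1 (cid (coordF i N)).
have cF i N : F [set w : 'I_n -> Ghat | pc_coord (w i) N = c i N].
  by rewrite /c; case: cid.
have cP i (N M : normal_fin_index G) : N `<=` M -> fin_quot_map M (c i N) = c i M.
  move=> NM; have [w [<- <-]] := filter_ex (filterI (cF i N) (cF i M)).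
  exact: pc_coordP.
exists (fun i => pc_mk (cP i)); split=> //=; apply: tuples_cvg => i N.
exact: cF.
Qed.

(** Local constancy gives a level at each point; compactness, applied along the filter of
    sufficiently small [N], makes it uniform. *)
Lemma continuous_cylinder (M : gmodule Ghat) n (f : ('I_n.+1 -> Ghat) -> M) :
  continuous_cochain f -> exists N, forall z w, cylinder z N w -> f w = f z.
Proof.
move=> /discrete_continuousP fc.
pose F := filter_from [set: normal_fin_index G]
  (fun N => [set P : normal_fin_index G | P `<=` N]).
have FF : Filter F.
  apply: filter_fromT_filter => [|N P]; first exact: nfi_inhabited.
  have [Q [QN QP]] := nfi_intersection N P; exists Q => R RQ.
  by split; exact: subset_trans RQ _.
have /compact_near_coveringP cov := @tuples_compact n.+1.
have [|N _ NP] := cov _ F (fun N z => forall w, cylinder z N w -> f w = f z) FF.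
  move=> z _; have /tuples_nbhsP[N NP] := fc z.
  exists (cylinder z N, [set P : normal_fin_index G | P `<=` N]).
    by split; [apply/tuples_nbhsP; exists N|exists N].
  move=> [w P] [/= wz PN] v vw; rewrite (NP w wz); apply: NP => i.
  by rewrite (cylinder_sub PN vw) wz.
by exists N => z w; apply: (NP N).
Qed.

Definition representatives n N (z : 'I_n -> Ghat) : 'I_n -> G :=
  fun i => repr (pc_coord (z i) N).

Lemma completion_representatives n N (z : 'I_n -> Ghat) :
  cylinder z N (@completion G \o representatives N z).
Proof. by move=> i; rewrite /representatives /=; exact: reprK. Qed.

Section Module.
Variable M : gmodule Ghat.
Hypothesis fM : finite_discrete_module M.

Local Notation MG := (restr_gmodule (@completion G) M).

Lemma continuous_pullback_finitary n (f : ('I_n.+1 -> Ghat) -> M) :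
  continuous_cochain f -> finitary (pullback (@completion G) f : _ -> MG).
Proof.
move=> /continuous_cylinder[N NP]; exists N => x u uN; apply: NP => i.
by apply/esym/eq_fin_quot; rewrite /= mulKg.
Qed.

(** The image of [G] is dense: it meets every cylinder, and [f] is constant on those of some
    level. *)
Lemma continuous_pullback_eq0 n (f : ('I_n.+1 -> Ghat) -> M) :
  continuous_cochain f -> pullback (@completion G) f = 0 -> f = 0.
Proof.
move=> /continuous_cylinder[N NP] f0; apply/funext => z.
rewrite -(NP z _ (completion_representatives N z)).
exact: (congr1 (fun f => f (representatives N z)) f0).
Qed.

Lemma gact_locally_constant (z : Ghat) (a : M) :
  exists N, forall w, pc_coord w N = pc_coord z N -> gact w a = gact z a.
Proof.
have /discrete_continuousP/(_ (z, a)) [[U V] [zU aV] UV] := fM.2.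
have [N NU] := pc_nbhs zU; exists N => w /NU wU.
by apply: (UV (w, a)); split=> //; exact: nbhs_singleton aV.
Qed.

(** [f] factors through a finite quotient, hence extends. For equivariance, [z] is replaced by an
    element of [G] close enough to have the same coordinate at [N] and the same action on the one
    value involved. *)
Lemma finitary_extension n (f : ('I_n.+1 -> G) -> MG) :
  equivariant f -> finitary f ->
  exists F : ('I_n.+1 -> Ghat) -> M,
    [/\ equivariant F, continuous_cochain F & pullback (@completion G) F = f].
Proof.
move=> fE [N fN].
have f_coset x y : (forall i, nfi_set N ((x i)^-1 * y i)%g) -> f y = f x.
  move=> xy; rewrite -(fN x (fun i => (x i)^-1 * y i)%g xy); congr f.
  by apply/funext => i; rewrite mulVKg.
exists (f \o representatives N); split.
- move=> z x; have [N' N'P] := gact_locally_constant z (f (representatives N x)).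
  have [P [PN PN']] := nfi_intersection N N'.
  pose g := repr (pc_coord z P).
  have gz (Q : normal_fin_index G) : P `<=` Q -> pc_coord (completion g) Q = pc_coord z Q.
    by move=> PQ; rewrite -!(pc_coordP _ PQ); congr fin_quot_map; exact: reprK.
  rewrite /= -(N'P _ (gz _ PN')) -[gact (completion g) _]/(@gact G MG g _) -fE.
  apply: f_coset => i; apply/eq_fin_quot.
  rewrite fin_quot_piM /representatives !reprK.
  by rewrite -[RHS]/(pc_coord z N * pc_coord (x i) N)%g -(gz _ PN).
- apply/discrete_continuousP => z; apply/tuples_nbhsP; exists N => w wz /=.
  by congr f; apply/funext => i; rewrite /representatives wz.
- by apply/funext => x; apply: f_coset => i /=; exact: repr_fin_quot.
Qed.

End Module.
End ProfiniteTopology.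

(** * Comparison of cohomologies *)

Lemma injective_surjective_bijective (T U : Type) (f : T -> U) :
  injective f -> (forall u, exists t, f t = u) -> bijective f.
Proof.
move=> fI fS; exists (fun u => projT1 (cid (fS u))) => [t|u]; last by case: cid.
by case: cid => s /= /fI.
Qed.

Lemma eq_cohomology (K : cochain_complex) n (x y : cocycle K n) :
  \pi_(cohomology K n)%qT x = \pi_(cohomology K n)%qT y <->
  is_coboundary_of (cocycle_val x - cocycle_val y).
Proof.
split=> [/eqP|xy]; last (apply/eqP; move: xy); rewrite -Quotient.idealrBE !unfold_in.
  by move=> /asboolP.
by move=> xy; apply/asboolP.
Qed.

Lemma diff_coboundary (K : cochain_complex) n (x : K n) :
  is_coboundary_of x -> diff K n x = 0.
Proof.
by case: n x => [|n] x /= => [->|[y ->]]; [exact: raddf0|exact: diff_diff].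
Qed.

Section Comparison.
Variables (G : groupType) (M : gmodule (profinite_completion G)).
Hypothesis fM : finite_discrete_module M.
Hypothesis G_effaceable :
  forall (A : gmodule G) q, finite_set [set: A] -> effaceable A id q.

Local Notation MG := (restr_gmodule (@completion G) M).
Local Notation pull := (@pullback_cochain G _ (@completion G) M _).

Lemma pullback_cochain_inj n : injective (@pullback_cochain G _ (@completion G) M n).
Proof.
move=> [f fP] [h hP] fh; apply/eqP; rewrite -subr_eq0; apply/eqP; apply: val_inj => /=.
have /asboolP[_ fhc] : f - h \in @is_cont_homog _ M n by exact: rpredB.
apply: (continuous_pullback_eq0 fhc).
have := congr1 (@homog_val _ _ _) fh => /= e.
by apply/funext => x; have := congr1 (fun k => k x) e => /= /eqP; rewrite -subr_eq0 => /eqP.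
Qed.

(** The case [g] = 0 gives surjectivity in degree [n]; a cocycle [g] whose pullback is a coboundary
    gives injectivity in degree [n.+1]. *)
Lemma pullback_decomposition n (f : homog_cochain MG n)
    (g : cont_homog_cochain M n.+1) :
  homog_cochain_diff f = pull g ->
  exists k : cont_homog_cochain M n,
    is_coboundary_of (K := group_complex MG) (f - pull k).
Proof.
case: f g => f fP [g gP] fg; have /asboolP fE := fP; have /asboolP[_ gc] := gP.
have df : homog_diff f = pullback (@completion G) g := congr1 (@homog_val _ _ _) fg.
have [|k [kE kF kB]] := @finitary_decomposition G G_effaceable n MG f fM.1 fE.
  by rewrite df; exact: continuous_pullback_finitary.
have [h [hE hc hk]] := finitary_extension fM kE kF.
have hP : h \in @is_cont_homog _ M n by apply/asboolP.
exists (ContHomogCochain hP); move: kB; rewrite -hk.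
case: n f fP fE g gP gc fg df k kE kF h hE hc hk hP
  => [|n] f fP fE g gP gc fg df k kE kF h hE hc hk hP /=.
  by move=> e; apply: val_inj.
move=> [e eE fe]; have eP : e \in @is_homog G MG n by apply/asboolP.
by exists (HomogCochain eP); apply: val_inj.
Qed.

Lemma pullback_cohomology_bijective n :
  bijective (@pullback_cohomology G _ (@completion G) M n).
Proof.
apply: injective_surjective_bijective => [c d|c]; last first.
  rewrite -[c]reprK; case: (repr c) => f fP; have /eqP df := fP.
  have [|k fk] := @pullback_decomposition n f 0; first by rewrite raddf0.
  have kP : k \in @is_cocycle (continuous_complex M) n.
    apply/eqP; apply: pullback_cochain_inj; rewrite raddf0.
    rewrite [LHS]pullback_cochain_diff.
    have : homog_cochain_diff (f - pull k) = 0 := diff_coboundary fk.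
    by rewrite raddfB df sub0r => /eqP; rewrite oppr_eq0 => /eqP.
  exists (\pi_(cohomology (continuous_complex M) n)%qT (Cocycle kP)).
  rewrite /pullback_cohomology cohomology_map_pi; apply/esym/eq_cohomology.
  exact: fk.
rewrite -[c]reprK -[d]reprK /pullback_cohomology !cohomology_map_pi.
move=> /eq_cohomology cd; apply/eq_cohomology; move: cd => /=.
set x := cocycle_val (repr c); set y := cocycle_val (repr d).
rewrite -raddfB; move: (x - y) => {x y}; case: n c d => [|n] c d g /=.
  by move=> g0; apply: pullback_cochain_inj; rewrite g0 raddf0.
move=> [f fg]; have [k fk] := pullback_decomposition (esym fg).
exists k; apply: pullback_cochain_inj; rewrite fg [RHS]pullback_cochain_diff.
have : homog_cochain_diff (f - pull k) = 0 := diff_coboundary fk.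
by rewrite raddfB => /eqP; rewrite subr_eq0 => /eqP.
Qed.

End Comparison.

Theorem theorem3p15 (G : groupType) (hG : right_angled_Artin G) (n : nat) :
  in_class_A n G.
Proof.
move=> M fM; have [X [gen [Sigma GP]]] := hG.
have G_effaceable (A : gmodule G) q : finite_set [set: A] -> effaceable A id q.
  have <- : retraction GP [set: X]%SET = id by apply/funext => g; exact: retractionT.
  exact: effaceable_retraction.
have bij i := pullback_cohomology_bijective fM G_effaceable i.
by split=> [i _|]; [exact: bij|exact: bij_inj].
Qed.
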